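(* Let $K\subset S^3$ be the figure eight knot. The $\lambda$-length between any two spin-decorated horospheres (with distinct centres) in the canonical hyperbolic structure on $S^3\setminus K$ is an Eisenstein integer. Moreover, for any nonzero Eisenstein integer $\alpha$, there exists a unit Eisenstein integer $u$ such that $u\alpha$ is the $\lambda$-length between two spin-decorated horospheres in the canonical hyperbolic structure on $S^3\setminus K$.
   Context: Let $\omega=-\frac12+\frac{\sqrt3}{2}i$. The Eisenstein integers are the elements of $\mathbb{Z}[\omega]$; the units are $\{\pm1,\pm\omega,\pm\omega^2\}$. **Canonical hyperbolic structure.** The knot group of the figure eight knot is $\pi_1(S^3\setminus K)=\langle x,y\mid y=wxw^{-1}\rangle$ with $w=x^{-1}yxy^{-1}$, and Riley's discrete faithful representation $\rho\colon\pi_1(S^3\setminus K)\to \mathrm{SL}_2(\mathbb{C})$ is given by $A=\rho(x)=\begin{pmatrix}1&1\\0&1\end{pmatrix}$, $B=\rho(y)=\begin{pmatrix}1&0\\-\omega&1\end{pmatrix}$. Let $\Gamma=\langle A,B\rangle\subset \mathrm{SL}_2(\mathbb{Z}[\omega])$ be its image. Then $S^3\setminus K\cong\mathbb{H}^3/\Gamma$, which is the canonical hyperbolic structure. **Spin-decorated horospheres.** Work in the upper half space model of $\mathbb{H}^3$, with $\partial\mathbb{H}^3=\mathbb{C}\cup\{\infty\}$. A decoration on a horosphere $\mathfrak{h}$ is a parallel unit tangent vector field $V$ on $\mathfrak{h}$ (for its Euclidean metric). It determines the frame fields $(N,V,N\times V)$ along $\mathfrak{h}$, where $N$ is a unit normal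 field: the inward frame field $F^{in}$ when $N$ points out of the horoball bounded by $\mathfrak{h}$ and into $\mathbb{H}^3$, and the outward frame field $F^{out}$ when $N$ points into the horoball. An inward (resp. outward) spin-decoration is a continuous lift of $F^{in}$ (resp. $F^{out}$) to the double cover of the frame bundle of $\mathbb{H}^3$. The outward spin-decoration associated to an inward one $W^{in}$ is obtained by rotating $W^{in}$ by $-\pi$ about $V$ at each point of $\mathfrak{h}$; the inward one associated to an outward one $W^{out}$ is obtained by rotating $W^{out}$ by $\pi$ about $V$. A spin-decoration on $\mathfrak{h}$ is a pair $(W^{in},W^{out})$ of associated inward and outward spin-decorations. Each decoration lifts to exactly two spin-decorations, related by $2\pi$ rotation. **Spinors.** A spinor is a nonzero vector $\begin{pmatrix}\xi\\ \eta\end{pmatrix}\in\mathbb{C}^2$. There is an $\mathrm{SL}_2(\mathbb{C})$-equivariant bijection (Mathews) between spinors and spin-decorated horospheres: if $\eta\neq0$, the horosphere is centred at $\xi/\eta$ with Euclidean height $|\eta|^{-2}$, and its decoration at its highest point is in the direction $i/\eta^2$; if $\eta=0$, the horosphere is centred at $\infty$, is the plane of height $|\xi|^2$, and its decoration is in the direction $i\xi^2$. The spin-decorated horospheres in the canonical hyperbolic structure on $S^3\setminus K$ are those corresponding to spinors in the $\Gamma$-orbit of $\begin{pmatrix}1\\0\end{pmatrix}$. **$\lambda$-length.** Let $\mathfrak{h},\mathfrak{h}'$ be spin-decorated horospheres with distinct centres, and let $\gamma$ be the geodesic oriented from the centre of $\mathfrak{h}$ to the centre of $\mathfrak{h}'$,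 meeting $\mathfrak{h}$ and $\mathfrak{h}'$ orthogonally at $p$ and $p'$. Let $\rho$ be the (signed) distance along $\gamma$ from $p$ to $p'$. Parallel transport the inward spin frame of $\mathfrak{h}$ at $p$ along $\gamma$ to $p'$, and let $\theta$ (well defined modulo $4\pi$) be the angle of rotation about $\gamma$ taking it to the outward spin frame of $\mathfrak{h}'$ at $p'$. The complex distance is $d=\rho+i\theta$, and the (complex) $\lambda$-length from $\mathfrak{h}$ to $\mathfrak{h}'$ is $\lambda=e^{d/2}$. By a theorem of Mathews, if $\mathfrak{h},\mathfrak{h}'$ correspond to the spinors $\begin{pmatrix}\xi\\ \eta\end{pmatrix},\begin{pmatrix}\xi'\\ \eta'\end{pmatrix}$, then $\lambda=\xi\eta'-\xi'\eta$. *)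

(* Defs.v *)
From HB Require Import structures.
From mathcomp Require Import all_boot all_order all_algebra.
From mathcomp Require Import all_classical all_reals all_analysis.
From mathcomp Require Import complex.

Set Implicit Arguments.
Unset Strict Implicit.
Unset Printing Implicit Defensive.

Import Order.TTheory GRing.Theory Num.Theory.
Import numFieldNormedType.Exports.

Local Open Scope classical_set_scope.
Local Open Scope ring_scope.
Local Open Scope complex_scope.

Local Notation Re := complex.Re.
Local Notation Im := complex.Im.

(** [R[i]] gets the topology of its norm, as every [numFieldType]. *)
HB.instance Definition _ (R : realType) := PseudoPointedMetric.copy R[i] R[i]^o.

(** Upper half space model of hyperbolic 3-space: a point or a tangent vector is
    a row [(x, y, t)], points satisfy [0 < t], the boundary is
    [C u {oo} = option R[i]], the metric is [(dx^2 + dy^2 + dt^2) / t^2] and the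
    orientation is the standard one of the coordinates [(x, y, t)]. *)

Section UpperHalfSpace.
Variable R : realType.
Implicit Types (p u v w : 'rV[R]_3) (z : R[i]) (F : 'M[R]_3) (g : 'M[R[i]]_2).

Definition vec (x y t : R) : 'rV[R]_3 := \row_(i < 3) [:: x; y; t]`_i.
Definition zc p : R[i] := p 0 0 +i* p 0 1.
Definition tc p : R := p 0 2.
Definition pt z (t : R) : 'rV[R]_3 := vec (Re z) (Im z) t.

Definition dot u v : R := (u *m v^T) 0 0.
Definition cross u v : 'rV[R]_3 :=
  vec (u 0 1 * v 0 2 - u 0 2 * v 0 1)
      (u 0 2 * v 0 0 - u 0 0 * v 0 2)
      (u 0 0 * v 0 1 - u 0 1 * v 0 0).

Definition sqnorm z : R := Re z ^+ 2 + Im z ^+ 2.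

(** Levi-Civita covariant derivative of the field [Y] along the curve [c].  The
    metric is [exp (2 phi)] times the Euclidean one with [phi = - ln t], so that
    [nabla_X Y = D_X Y + X(phi) Y + Y(phi) X - <X, Y> grad phi]. *)
Definition cov (c Y : R -> 'rV[R]_3) (s : R) : 'rV[R]_3 :=
  let X := derive1 c s in
  derive1 Y s - (tc (c s))^-1 *:
    (tc X *: Y s + tc (Y s) *: X - dot X (Y s) *: vec 0 0 1).

Definition parallel_along (c Y : R -> 'rV[R]_3) : Prop :=
  forall s, derivable Y s 1 /\ cov c Y s = 0.

Definition unit_speed_geodesic (c : R -> 'rV[R]_3) : Prop :=
  (forall s, [/\ 0 < tc (c s), derivable c s 1 &
                 dot (derive1 c s) (derive1 c s) = tc (c s) ^+ 2])
  /\ parallel_along c (derive1 c).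

Definition tends_to_boundary (c : R -> 'rV[R]_3) (l : set_system R)
    (b : option R[i]) : Prop :=
  match b with
  | Some z => c s @[s --> l] --> pt z 0
  | None => `|c s| @[s --> l] --> +oo
  end.

(** The geodesics here are parametrised by the whole real line. *)
Definition geodesic_from_to (b b' : option R[i]) (c : R -> 'rV[R]_3) : Prop :=
  [/\ unit_speed_geodesic c,
      tends_to_boundary c (ninfty_nbhs R) b &
      tends_to_boundary c (pinfty_nbhs R) b'].

(** A frame at [p] is the matrix whose rows are its three vectors; for the
    hyperbolic metric it is orthonormal when [F *m F^T = (tc p ^+ 2)%:M]. *)
Definition frame u v w : 'M[R]_3 := \matrix_(i < 3) [:: u; v; w]`_i.

(** [rotate k s F] is [F] rotated by the angle [s] about its [k]-th vector,
    anticlockwise for the orientation of [F] (indices are taken mod 3). *)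
Definition rotate (k : 'I_3) (s : R) F : 'M[R]_3 :=
  \matrix_(i < 3)
    if i == k then row k F
    else if i == k + 1 then cos s *: row (k + 1) F + sin s *: row (k + 2) F
    else cos s *: row (k + 2) F - sin s *: row (k + 1) F.

(** The Poincare extension of [z |-> (a z + b) / (c z + d)]. *)
Definition mobius g p : 'rV[R]_3 :=
  let a := g 0 0 in let b := g 0 1 in let c := g 1 0 in let d := g 1 1 in
  let z := zc p in let t := tc p in
  let D := sqnorm (c * z + d) + sqnorm c * t ^+ 2 in
  pt (((a * z + b) * conjc (c * z + d) + a * conjc c * (t ^+ 2)%:C) / D%:C) (t / D).

Definition base_point : 'rV[R]_3 := vec 0 0 1.
Definition base_frame : 'M[R]_3 := frame (vec 0 0 (-1)) (vec 0 1 0) (vec 1 0 0).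

(** Orientation-preserving isometries act simply transitively on positive
    orthonormal frames, and [PSL_2(C)] is the group of those isometries.  Hence
    [SL_2(C)] is the spin double cover of the frame bundle, the covering map
    sending [g] to the image of the base frame under the isometry of [g]. *)
Definition spin_frame : set 'M[R[i]]_2 := [set g | \det g = 1].
Definition point_of g : 'rV[R]_3 := mobius g base_point.
Definition frame_of g : 'M[R]_3 :=
  \matrix_(i < 3) 'D_(row i base_frame) (mobius g) base_point.

(** [g'] is [g] rotated by the angle [theta] about the [k]-th vector of its
    frame: the end of the lift, starting at [g], of the path of rotated frames.
    Thus the rotation by [2 * pi] is not trivial, the one by [4 * pi] is. *)
Definition spin_rotation (k : 'I_3) (theta : R) g g' : Prop :=
  exists P : R -> 'M[R[i]]_2,
    [/\ continuous P, P 0 = g, P theta = g' &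
        forall s, [/\ P s \in spin_frame, point_of (P s) = point_of g &
                      frame_of (P s) = rotate k s (frame_of g)]].

Definition spin_parallel_along (c : R -> 'rV[R]_3) (P : R -> 'M[R[i]]_2) : Prop :=
  [/\ continuous P,
      forall s, P s \in spin_frame /\ point_of (P s) = c s &
      forall i : 'I_3, parallel_along c (fun s => row i (frame_of (P s)))].

(** The horosphere centred at [b] with Euclidean height (diameter, for a finite
    centre) [d]. *)
Definition horosphere (b : option R[i]) (d : R) : set 'rV[R]_3 :=
  match b with
  | Some z => [set p | 0 < tc p /\ sqnorm (zc p - z) + tc p ^+ 2 = d * tc p]
  | None => [set p | tc p = d]
  end.

(** The unit normal, at a point [p] of the horosphere, that points out of the
    horoball. *)
Definition normal (b : option R[i]) (d : R) p : 'rV[R]_3 :=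
  match b with
  | Some z => (tc p / (d / 2)) *: (p - pt z (d / 2))
  | None => tc p *: vec 0 0 (-1)
  end.

(** The induced metric on a horosphere is flat, and its Levi-Civita connection
    is the tangential part of the ambient one. *)
Definition parallel_unit_tangent_field (b : option R[i]) (d : R)
    (V : 'rV[R]_3 -> 'rV[R]_3) : Prop :=
  (forall p, horosphere b d p ->
     dot (V p) (normal b d p) = 0 /\ dot (V p) (V p) = tc p ^+ 2)
  /\ (forall c : R -> 'rV[R]_3,
       (forall s, horosphere b d (c s) /\ derivable c s 1) ->
       forall s, derivable (V \o c) s 1 /\
         exists m : R, cov c (V \o c) s = m *: normal b d (c s)).

(** The frame [(N, V, N x V)] at [p]; the factor makes the Euclidean cross
    product the hyperbolic one. *)
Definition frame_NV p (N V : 'rV[R]_3) : 'M[R]_3 :=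
  frame N V ((tc p)^-1 *: cross N V).

Definition spin_lift (h : set 'rV[R]_3) (F : 'rV[R]_3 -> 'M[R]_3)
    (W : 'rV[R]_3 -> 'M[R[i]]_2) : Prop :=
  {within h, continuous W} /\
  forall p, h p -> [/\ W p \in spin_frame, point_of (W p) = p &
                       frame_of (W p) = F p].

(** The values of the three fields [dec], [win], [wout] outside the horosphere
    are irrelevant. *)
Record spin_decorated_horosphere := SpinDecoratedHorosphere {
  centre : option R[i];
  height : R;
  dec : 'rV[R]_3 -> 'rV[R]_3;
  win : 'rV[R]_3 -> 'M[R[i]]_2;
  wout : 'rV[R]_3 -> 'M[R[i]]_2;
  height_gt0 : 0 < height;
  dec_parallel : parallel_unit_tangent_field centre height dec;
  win_lift : spin_lift (horosphere centre height)
    (fun p => frame_NV p (normal centre height p) (dec p)) win;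
  wout_lift : spin_lift (horosphere centre height)
    (fun p => frame_NV p (- normal centre height p) (dec p)) wout;
  win_wout : forall p, horosphere centre height p ->
    spin_rotation 1 (- pi) (win p) (wout p)
}.

Definition horo (H : spin_decorated_horosphere) : set 'rV[R]_3 :=
  horosphere (centre H) (height H).

(** [H] is the spin-decorated horosphere of the spinor [k = (xi, eta)].  The
    vectors [i / eta^2] and [i xi^2] have hyperbolic length 1 at the relevant
    points. *)
Definition decoration_of_spinor (k : 'cV[R[i]]_2)
    (H : spin_decorated_horosphere) : Prop :=
  let xi := k 0 0 in let eta := k 1 0 in
  if eta == 0 then
    [/\ centre H = None, height H = sqnorm xi &
        forall p, horo H p -> dec H p = pt ((0 +i* 1) * xi ^+ 2) 0]
  else
    [/\ centre H = Some (xi / eta), height H = (sqnorm eta)^-1 &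
        dec H (pt (xi / eta) (height H)) = pt ((0 +i* 1) / eta ^+ 2) 0].

(** The previous condition leaves two spin lifts.  The choice is made by
    equivariance: the inward spin frame of the horosphere of [(1, 0)] at
    [base_point], which lies over [base_frame], is [1], so that the one of the
    horosphere of [g (1, 0)] at the image of [base_point] under [g] is [g].
    (Starting from the lift [-1] negates the whole correspondence.) *)
Definition spinor_horosphere (k : 'cV[R[i]]_2)
    (H : spin_decorated_horosphere) : Prop :=
  [/\ k != 0, decoration_of_spinor k H &
      forall g, g \in spin_frame -> col 0 g = k ->
        win H (mobius g base_point) = g].

(** [rho + i theta] is a complex distance from [H] to [H']; [theta] is only
    determined modulo [4 * pi].  The first vector of the inward frame at [c s]
    is the velocity of [c], so rotating about it is rotating about [c]. *)
Definition complex_distance (H H' : spin_decorated_horosphere)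
    (rho theta : R) : Prop :=
  exists c : R -> 'rV[R]_3, exists s s' : R, exists P : R -> 'M[R[i]]_2,
    [/\ geodesic_from_to (centre H) (centre H') c,
        horo H (c s) /\ horo H' (c s'),
        rho = s' - s,
        spin_parallel_along c P /\ P s = win H (c s) &
        spin_rotation 0 theta (P s') (wout H' (c s'))].

Definition cexp z : R[i] := (expR (Re z))%:C * (cos (Im z) +i* sin (Im z)).

Definition lambda_length (H H' : spin_decorated_horosphere) (l : R[i]) : Prop :=
  exists rho theta, complex_distance H H' rho theta /\
    l = cexp ((rho +i* theta) / 2).

Definition omega : R[i] := (- (1 / 2)) +i* (Num.sqrt 3 / 2).

Definition eisenstein (a : R[i]) : Prop :=
  exists m n : int, a = m%:~R + n%:~R * omega.

Definition eisenstein_unit (a : R[i]) : Prop :=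
  eisenstein a /\ exists b, eisenstein b /\ a * b = 1.

Definition mx22 (a b c d : R[i]) : 'M[R[i]]_2 :=
  \matrix_(i < 2, j < 2) (nth [::] [:: [:: a; b]; [:: c; d]] i)`_j.

(** The images of [x] and [y] under Riley's representation. *)
Definition riley_A : 'M[R[i]]_2 := mx22 1 1 0 1.
Definition riley_B : 'M[R[i]]_2 := mx22 1 0 (- omega) 1.

Definition subgroup_SL2 (G : set 'M[R[i]]_2) : Prop :=
  [/\ G `<=` [set g | \det g = 1], G 1,
      forall g h, G g -> G h -> G (g * h) & forall g, G g -> G g^-1].

Definition figure_eight_group : set 'M[R[i]]_2 :=
  smallest subgroup_SL2 [set riley_A; riley_B].

Definition figure_eight_horosphere (H : spin_decorated_horosphere) : Prop :=
  exists2 g, figure_eight_group g &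
    spinor_horosphere (g *m (\col_(i < 2) [:: 1; 0]`_i)) H.

End UpperHalfSpace.

(* Main.v *)
Require Import Defs.
From mathcomp Require Import all_boot all_order all_algebra.
From mathcomp Require Import all_classical all_reals all_analysis.
From mathcomp Require Import complex.
From mathcomp Require Import ring lra.

(** Why the theorem holds.  Spin frames are the elements of SL2(C), and both the
    point and the frame carried by a matrix [g] are explicit functions of its
    entries ([point_ofE], [frame_ofE]); the frame depends on the second row only,
    and the frame together with the point determines [g] up to sign
    ([spin_frame_determined]).  Moving a spin frame inside its own reference system
    is multiplication on the right: by [diag (e^(-s/2), e^(s/2))] it is transported
    along the geodesic that leaves in the direction of its first vector
    ([is_derive_geo], [spin_parallel_geo]), and by [diag (e^(-it/2), e^(it/2))] it
    turns by [t] about that vector.  The inward spin frames of the horosphere of a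
    spinor [k] are the matrices with first column [k], and the outward ones, turned
    by [- pi] about the second vector, are those with second column [k]
    ([spinor_win]).

    Let [k] and [k'] have determinant [lam <> 0].  The matrix with columns [k] and
    [k' / lam] is the inward frame of the first horosphere at the point where the
    geodesic to the second centre leaves it.  Transport over [rho] and rotation by
    [theta] multiply its second column by [e^((rho + i theta)/2)], and the result is
    the outward frame of the second horosphere exactly when that column is [k'], that
    is, when [e^((rho + i theta)/2) = lam].  This is [lambda_length_of_spinors].

    The lambda-length is defined through the existence of a geodesic, of a parallel
    spin frame and of a rotation, so its uniqueness needs that all of them are the
    explicit ones.  Geodesics with the same initial velocity coincide, because [1/t]
    satisfies a linear equation and [x'/t^2], [y'/t^2] are constant
    ([geodesic_unique]); some explicit geodesic starts with any given unit vector
    ([frame_transitive]); its end points are the ratios of the columns of its matrix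
    ([geo_ninfty], [geo_pinfty]).  Parallel frames along one curve have constant
    inner products, and two continuous lifts of the same frames differ by a sign that
    cannot change ([spin_parallel_unique]).

    For the figure eight knot, the matrices of the group have Eisenstein entries, so
    the determinant of two spinors of the orbit is an Eisenstein integer.  Conversely
    the lambda-length from [(1, 0)] to the image [(x, y)] of [(1, 0)] is [y], so it is
    enough that every [a] occurs, up to a unit, as a second coordinate in the orbit of
    [(1, 0)].  The group acts transitively on the cusps: translation by 1 and by
    the longitude generate a lattice of index 4 in the Eisenstein integers, with
    representatives [- omega, 0, omega, 2 omega], and each of these four is a ratio in
    the orbit ([orbit_ratio_eisenstein]).  Moving by the group element that takes
    infinity to 0 then gives the vector [(1, a)] up to a unit
    ([orbit_second_coordinate]).  The horospheres themselves are built, for any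
    spinor, in [horosphere_of]. *)

Set Implicit Arguments.
Unset Strict Implicit.
Unset Printing Implicit Defensive.

Import Order.TTheory GRing.Theory Num.Theory.
Import numFieldNormedType.Exports.

Local Open Scope classical_set_scope.
Local Open Scope ring_scope.
Local Open Scope complex_scope.
Local Notation Re := complex.Re.
Local Notation Im := complex.Im.
Local Notation "z ^*" := (conjc z) : ring_scope.

(** * Coordinates on the upper half space *)

Section Coordinates.
Variable R : realType.
Implicit Types (u v w p : 'rV[R]_3) (z : R[i]) (F : 'M[R]_3) (g : 'M[R[i]]_2).

Lemma vec0 (x y t : R) : vec x y t 0 0 = x. Proof. by rewrite mxE. Qed.
Lemma vec1 (x y t : R) : vec x y t 0 1 = y. Proof. by rewrite mxE. Qed.
Lemma vec2 (x y t : R) : vec x y t 0 2 = t. Proof. by rewrite mxE. Qed.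
Definition vecE := (vec0, vec1, vec2).

(** The indices of a 3-vector, given as the numerals in which the definitions are
    written. *)
Lemma ord3P (P : 'I_3 -> Prop) : P 0 -> P 1 -> P 2 -> forall i, P i.
Proof.
move=> P0 P1 P2 [[|[|[|//]]] Hi].
- by rewrite (_ : Ordinal Hi = 0) //; exact: val_inj.
- by rewrite (_ : Ordinal Hi = 1) //; exact: val_inj.
- by rewrite (_ : Ordinal Hi = 2) //; exact: val_inj.
Qed.

Lemma rV3P u v : u 0 0 = v 0 0 -> u 0 1 = v 0 1 -> u 0 2 = v 0 2 -> u = v.
Proof. by move=> e0 e1 e2; apply/rowP; exact: ord3P. Qed.

Lemma vec_eta v : v = vec (v 0 0) (v 0 1) (v 0 2).
Proof. by apply: rV3P; rewrite ?vecE. Qed.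

Lemma vecZ (k x y t : R) : k *: vec x y t = vec (k * x) (k * y) (k * t).
Proof. by apply: rV3P; rewrite ?mxE. Qed.

Lemma vecD (x y t x' y' t' : R) :
  vec x y t + vec x' y' t' = vec (x + x') (y + y') (t + t').
Proof. by apply: rV3P; rewrite ?mxE. Qed.

Lemma vecB (x y t x' y' t' : R) :
  vec x y t - vec x' y' t' = vec (x - x') (y - y') (t - t').
Proof. by apply: rV3P; rewrite ?mxE. Qed.

Lemma dotE u v : dot u v = u 0 0 * v 0 0 + u 0 1 * v 0 1 + u 0 2 * v 0 2.
Proof.
rewrite /dot mxE !big_ord_recr big_ord0 /= add0r !mxE.
congr (_ * _ + _ * _ + _ * _); by [congr (u _ _); exact: val_inj | congr (v _ _);
  exact: val_inj].
Qed.

Lemma row0_frame u v w : row 0 (frame u v w) = u.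
Proof. by apply/rowP => j; rewrite !mxE. Qed.
Lemma row1_frame u v w : row 1 (frame u v w) = v.
Proof. by apply/rowP => j; rewrite !mxE. Qed.
Lemma row2_frame u v w : row 2 (frame u v w) = w.
Proof. by apply/rowP => j; rewrite !mxE. Qed.
Definition row_frameE := (row0_frame, row1_frame, row2_frame).

Lemma tc_vec x y t : tc (vec x y t) = t :> R. Proof. exact: vec2. Qed.
Lemma zc_vec x y t : zc (vec x y t) = x +i* y :> R[i].
Proof. by rewrite /zc !vecE. Qed.

End Coordinates.

(** * Derivatives of curves and of quotients *)

Section Derivatives.
Variable R : realType.

(** Reduces a directional derivative to a derivative in one real variable, where
    quotients can be differentiated. *)
Lemma is_derive_line (V W : normedModType R) (f : V -> W) a v l :
  is_derive (0 : R) 1 (fun h => f (h *: v + a)) l -> is_derive a v f l.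
Proof.
case=> d e.
have E : (fun h : R => h^-1 *: ((f \o shift a) (h *: v) - f a)) =
  (fun h : R => h^-1 *: (((fun h => f (h *: v + a)) \o shift 0) (h *: 1) - f (0 *: v +
    a))).
  apply/funext => h /=; rewrite addr0 scale0r add0r.
  by have -> : h *: (1 : R) = h by rewrite /GRing.scale /= mulr1.
split; last by rewrite -e /derive E.
by move: d; rewrite /derivable -E.
Qed.

Lemma is_derive_coord (V : normedModType R) (Y : V -> 'rV[R]_3) a v (l : 'rV[R]_3) j :
  is_derive a v Y l -> is_derive a v (fun p => Y p 0 j) (l 0 j).
Proof.
case=> d e; split; first by move/derivable_mxP: d.
by rewrite -e derive_mx // mxE.
Qed.

Lemma is_derive_rV3 (V : normedModType R) (Y : V -> 'rV[R]_3) a v (l : 'rV[R]_3) :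
  is_derive a v (fun p => Y p 0 0) (l 0 0) ->
  is_derive a v (fun p => Y p 0 1) (l 0 1) ->
  is_derive a v (fun p => Y p 0 2) (l 0 2) -> is_derive a v Y l.
Proof.
move=> [d0 e0] [d1 e1] [d2 e2].
have d : derivable Y a v.
  by apply/derivable_mxP => i j; rewrite (ord1 i); elim/ord3P: j;
    [exact: d0|exact: d1|exact: d2].
by split=> //; rewrite derive_mx //; apply: rV3P; rewrite mxE.
Qed.

Lemma is_derive_quot (f g : R -> R) (x df dg : R) :
  g x != 0 -> is_derive x 1 f df -> is_derive x 1 g dg ->
  is_derive x 1 (fun y => f y / g y) ((df * g x - f x * dg) / g x ^+ 2).
Proof.
move=> g0 Hf Hg; have Hi := is_deriveV g0 Hg.
have := @is_deriveM _ _ f (fun y => (g y)^-1) x 1 _ _ Hf Hi.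
move/is_derive_eq; apply; rewrite /GRing.scale /=; field. exact: g0.
Qed.

Lemma is_derive_quad (n0 n1 n2 : R) : is_derive (0:R) 1 (fun h => n0 + n1 * h +
  n2 * h ^+ 2) n1.
Proof.
apply: is_derive_eq; rewrite /GRing.scale /=. ring.
Qed.

(** Along a line a Moebius map is a quotient of quadratic polynomials, of which
    only the coefficients of degree 0 and 1 matter. *)
Lemma is_derive_quad_quot (f : R -> R) (n0 n1 n2 m0 m1 m2 l : R) : m0 != 0 ->
  (forall h, f h = (n0 + n1 * h + n2 * h ^+ 2) / (m0 + m1 * h + m2 * h ^+ 2)) ->
  l * m0 ^+ 2 = n1 * m0 - n0 * m1 ->
  is_derive (0:R) 1 f l.
Proof.
move=> m00 /funext-> el.
have h0 : m0 + m1 * 0 + m2 * 0 ^+ 2 != 0 by rewrite expr0n /= !mulr0 !addr0.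
have := @is_derive_quot (fun h => n0 + n1 * h + n2 * h ^+ 2)
  (fun h => m0 + m1 * h + m2 * h ^+ 2) 0 _ _ h0 (is_derive_quad n0 n1 n2)
    (is_derive_quad m0 m1 m2).
move/is_derive_eq; apply; rewrite expr0n /= !mulr0 !addr0 -el mulfK //.
by rewrite expf_neq0.
Qed.

Lemma div_real_complex (x : R[i]) (r : R) : x / r%:C = (Re x / r) +i* (Im x / r).
Proof. by rewrite -fmorphV; case: x => x y; rewrite /real_complex_def; simpc. Qed.

End Derivatives.

(** * The point and the frame of a matrix in SL2(C) *)

Section Frames.
Variable R : realType.
Implicit Types (p : 'rV[R]_3) (a b c d z : R[i]) (g : 'M[R[i]]_2).

(** The image of the base frame under the isometry of a matrix with second row
    [(c, d)]: the factor [ad - bc = 1] removes the first row from the derivative.  The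
    vectors are the products [cd], [c^2 + d^2], [d^2 - c^2] of a spin representation,
    which is why [(c, d)] and [- (c, d)] give the same frame. *)
Definition frame_cd c d : 'M[R]_3 :=
  (sqnorm c + sqnorm d) ^- 2 *:
  frame (pt (- (2 * (c * d)^*)) (sqnorm c - sqnorm d))
        (pt ((0 +i* 1) * (c^* ^+ 2 + d^* ^+ 2)) (2 * Im (c * d^*)))
        (pt (d^* ^+ 2 - c^* ^+ 2) (- (2 * Re (c * d^*)))).

Definition point_abcd a b c d : 'rV[R]_3 :=
  (sqnorm c + sqnorm d)^-1 *: pt (a * c^* + b * d^*) 1.

Lemma det2 g : \det g = g 0 0 * g 1 1 - g 0 1 * g 1 0.
Proof.
rewrite (expand_det_row _ 0) !big_ord_recl big_ord0 /cofactor !det_mx11 !mxE /=.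
rewrite !expr0 mul1r addr0 /bump /= expr1 mulN1r mulrN.
by congr (_ * _ - _ * _); congr (g _ _); exact: val_inj.
Qed.

Lemma sqnorm_ge0 z : 0 <= sqnorm z. Proof. by rewrite addr_ge0 ?sqr_ge0. Qed.
Lemma sqnorm_eq0 z : (sqnorm z == 0) = (z == 0).
Proof. by case: z => x y; rewrite eq_complex /sqnorm /= paddr_eq0 ?sqr_ge0 //
  !sqrf_eq0. Qed.
Lemma sqnorm_gt0 z : z != 0 -> 0 < sqnorm z.
Proof. by rewrite lt_def sqnorm_ge0 sqnorm_eq0 andbT. Qed.
Lemma sqnorm2_gt0 g : \det g = 1 -> 0 < sqnorm (g 1 0) + sqnorm (g 1 1).
Proof.
move=> dg; have := sqnorm_ge0 (g 1 0); rewrite le_eqVlt => /orP[|h];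
  last by rewrite ltr_wpDr ?sqnorm_ge0.
rewrite eq_sym sqnorm_eq0 => /eqP c0; rewrite ltr_wpDl ?sqnorm_ge0 // sqnorm_gt0 //.
apply/eqP => d0; move: dg; rewrite det2 c0 d0 !mulr0 subrr => /esym/eqP.
by rewrite oner_eq0.
Qed.

Lemma sqnormM : {morph @sqnorm R : x y / x * y}.
Proof. by case=> [? ?] [? ?]; rewrite /sqnorm /=; ring. Qed.

Lemma sqnorm_conj z : sqnorm (z^*) = sqnorm z.
Proof. by case: z => x y; rewrite /sqnorm /= sqrrN. Qed.
Lemma sqnormN z : sqnorm (- z) = sqnorm z.
Proof. by case: z => x y; rewrite /sqnorm /= !sqrrN. Qed.
Lemma sqnorm_realc (x : R) : sqnorm x%:C = x ^+ 2.
Proof. by rewrite /sqnorm /= expr0n addr0. Qed.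
Lemma sqnorm_sqr z : sqnorm (z ^+ 2) = sqnorm z ^+ 2.
Proof. by rewrite !expr2 sqnormM. Qed.

Lemma sqnormE z : (sqnorm z)%:C = z * z^*.
Proof. by case: z => x y; apply/eqP; rewrite eq_complex /sqnorm /=; apply/andP; split;
  apply/eqP; ring. Qed.

Lemma point_ofE g : point_of g = point_abcd (g 0 0) (g 0 1) (g 1 0) (g 1 1).
Proof.
rewrite /point_of /mobius /base_point tc_vec zc_vec /point_abcd.
set a := g 0 0; set b := g 0 1; set c := g 1 0; set d := g 1 1.
rewrite (_ : 0 +i* 0 = 0) // expr1n (_ : 1%:C = 1) // !mulr0 !add0r !mulr1 [_ +
  a * _]addrC [sqnorm d + _]addrC.
rewrite div_real_complex /pt /=.
by rewrite vecZ ![_^-1 * _]mulrC.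
Qed.

Lemma mobius_vec g (x y t : R) : mobius g (vec x y t) =
  let z := x +i* y in
  let D := sqnorm (g 1 0 * z + g 1 1) + sqnorm (g 1 0) * t ^+ 2 in
  let N := (g 0 0 * z + g 0 1) * (g 1 0 * z + g 1 1)^* +
    g 0 0 * (g 1 0)^* * (t^+2)%:C in
  vec (Re N / D) (Im N / D) (t / D).
Proof. by rewrite /mobius tc_vec zc_vec div_real_complex /pt. Qed.

(** The numerators contain the real and imaginary parts of [ad - bc]; they are
    replaced by 1 and 0 through [key1] and [key2], which reinsert the determinant so that
    the identity becomes a polynomial one. *)
Lemma is_derive_mobius g (v : 'rV[R]_3) : \det g = 1 ->
  let D := sqnorm (g 1 0) + sqnorm (g 1 1) in
  let dz := (g 1 1)^* ^+ 2 * zc v - (g 1 0)^* ^+ 2 * (zc v)^*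
            + 2 * (g 1 0 * g 1 1)^* * (tc v)%:C in
  is_derive (base_point R) v (mobius g)
   (D ^- 2 *: pt dz (((sqnorm (g 1 1) - sqnorm (g 1 0)) * tc v
      - 2 * Re (g 1 0 * (g 1 1)^* * zc v)))).
Proof.
move=> dg D dz; have D0 : D != 0 by rewrite gt_eqF ?sqnorm2_gt0.
apply: is_derive_line.
pose x := v 0 0; pose y := v 0 1; pose t := v 0 2.
have E : (fun h : R => mobius g (h *: v + base_point R)) =
  fun h => mobius g (vec (h * x) (h * y) (1 + h * t)).
  apply/funext => h; congr (mobius g _); apply: rV3P;
    rewrite /base_point ?vecE !mxE /= ?addr0 //.
  by rewrite addrC.
rewrite E {E}; under [X in is_derive _ _ X]funext => h do rewrite mobius_vec.
rewrite /= /dz /zc /tc -/x -/y -/t /D in D0 *.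
move: D0 dg; rewrite det2; case: (g 0 0) (g 0 1) (g 1 0) (g 1 1) => [a1 a2] [b1 b2]
  [c1 c2] [d1 d2].
rewrite /sqnorm /= => D0 dg; have := dg => -[] /= dg1 dg2.
pose p1 := a1 * x - a2 * y; pose p2 := a1 * y + a2 * x.
pose q1 := c1 * x - c2 * y; pose q2 := c1 * y + c2 * x.
pose e1 := a1 * c1 + a2 * c2; pose e2 := a2 * c1 - a1 * c2.
pose k := c1 ^+ 2 + c2 ^+ 2.
have key1 (u1 u2 : R) : u1 = u1 * (a1 * d1 - a2 * d2 - (b1 * c1 - b2 * c2))
   - u2 * (a1 * d2 + a2 * d1 - (b1 * c2 + b2 * c1))
       by rewrite dg1 dg2 mulr1 mulr0 subr0.
have key2 (u1 u2 : R) : u2 = u2 * (a1 * d1 - a2 * d2 - (b1 * c1 - b2 * c2))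
   + u1 * (a1 * d2 + a2 * d1 - (b1 * c2 + b2 * c1))
       by rewrite dg1 dg2 mulr1 mulr0 addr0.
pose w1 := (d1 ^+ 2 - d2 ^+ 2) * x + 2 * d1 * d2 * y - (c1 ^+ 2 - c2 ^+ 2) * x +
  2 * c1 * c2 * y
  + 2 * (c1 * d1 - c2 * d2) * t.
pose w2 := (d1 ^+ 2 - d2 ^+ 2) * y - 2 * d1 * d2 * x + (c1 ^+ 2 - c2 ^+ 2) * y +
  2 * c1 * c2 * x
  - 2 * (c1 * d2 + c2 * d1) * t.
apply: is_derive_rV3.
- apply: (@is_derive_quad_quot _ _ (b1*d1+b2*d2+e1) (p1*d1+b1*q1+p2*d2+b2*q2+2*e1*t)
   (p1*q1+p2*q2+e1*t^+2) (c1 ^+ 2 + c2 ^+ 2 + (d1 ^+ 2 + d2 ^+ 2))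
   (2*(d1*q1+d2*q2+k*t)) (q1^+2+q2^+2+k*t^+2)) => //.
    move=> h; rewrite vec0; congr (_ / _); rewrite /p1 /p2 /q1 /q2 /e1 /k; ring.
  rewrite /pt vecZ vec0 mulrAC mulVf ?expf_neq0 // mul1r.
  transitivity w1; first by rewrite /w1 /= !expr2 /=; ring.
  rewrite (key1 w1 w2) /w1 /w2 /p1 /p2 /q1 /q2 /e1 /k; ring.
- apply: (@is_derive_quad_quot _ _ (b2*d1-b1*d2+e2) (p2*d1+b2*q1-p1*d2-b1*q2+2*e2*t)
   (p2*q1-p1*q2+e2*t^+2) (c1 ^+ 2 + c2 ^+ 2 + (d1 ^+ 2 + d2 ^+ 2))
   (2*(d1*q1+d2*q2+k*t)) (q1^+2+q2^+2+k*t^+2)) => //.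
    move=> h; rewrite vec1; congr (_ / _); rewrite /p1 /p2 /q1 /q2 /e2 /k; ring.
  rewrite /pt vecZ vec1 mulrAC mulVf ?expf_neq0 // mul1r.
  transitivity w2; first by rewrite /w2 /= !expr2 /=; ring.
  rewrite (key2 w1 w2) /w1 /w2 /p1 /p2 /q1 /q2 /e2 /k; ring.
- apply: (@is_derive_quad_quot _ _ 1 t 0 (c1 ^+ 2 + c2 ^+ 2 + (d1 ^+ 2 + d2 ^+ 2))
   (2*(d1*q1+d2*q2+k*t)) (q1^+2+q2^+2+k*t^+2)) => //.
    move=> h; rewrite vec2; congr (_ / _); rewrite /q1 /q2 /k; ring.
  rewrite /pt vecZ vec2 mulrAC mulVf ?expf_neq0 // mul1r /q1 /q2 /k; ring.
Qed.

Lemma row0_frame_cd c d : row 0 (frame_cd c d) = (sqnorm c + sqnorm d) ^- 2 *: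
  pt (- (2 * (c * d)^*)) (sqnorm c - sqnorm d).
Proof. by rewrite linearZ /= row_frameE. Qed.
Lemma row1_frame_cd c d : row 1 (frame_cd c d) = (sqnorm c + sqnorm d) ^- 2 *:
  pt ((0 +i* 1) * (c^* ^+ 2 + d^* ^+ 2)) (2 * Im (c * d^*)).
Proof. by rewrite linearZ /= row_frameE. Qed.
Lemma row2_frame_cd c d : row 2 (frame_cd c d) = (sqnorm c + sqnorm d) ^- 2 *:
  pt (d^* ^+ 2 - c^* ^+ 2) (- (2 * Re (c * d^*))).
Proof. by rewrite linearZ /= row_frameE. Qed.

Lemma frame_ofE g : \det g = 1 -> frame_of g = frame_cd (g 1 0) (g 1 1).
Proof.
move=> dg; apply/row_matrixP => i; rewrite rowK.
rewrite (@derive_val _ _ _ _ _ _ _ (is_derive_mobius _ dg)).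
case: (g 1 0) (g 1 1) => [c1 c2] [d1 d2].
move: i; apply: ord3P; rewrite (row0_frame_cd, row1_frame_cd,
  row2_frame_cd) row_frameE tc_vec zc_vec; congr (_ *: _).
- by rewrite /pt /sqnorm /=; congr vec; ring.
- by rewrite /pt /sqnorm !expr2 /=; congr vec; ring.
- by rewrite /pt /sqnorm !expr2 /=; congr vec; ring.
Qed.
End Frames.

(** * Rotating a spin frame *)

Section Rotations.
Variable R : realType.
Implicit Types (p : 'rV[R]_3) (a b c d z : R[i]) (g : 'M[R[i]]_2).

Lemma mul_trmx_dot (F G : 'M[R]_3) i j : (F *m G^T) i j = dot (row i F) (row j G).
Proof. by rewrite dotE mxE !big_ord_recl big_ord0 addr0 !mxE addrA;
 congr (_ * _ + _ * _ + _ * _); congr fun_of_matrix; exact: val_inj. Qed.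

Lemma dot_sym (u v : 'rV[R]_3) : dot u v = dot v u.
Proof. by rewrite !dotE; ring. Qed.

(** An isometry is conformal; its factor at the base point is the height
    [1 / (|c|^2 + |d|^2)] of the image. *)
Lemma frame_cd_orthonormal c d : sqnorm c + sqnorm d != 0 ->
  frame_cd c d *m (frame_cd c d)^T = ((sqnorm c + sqnorm d) ^- 2)%:M.
Proof.
move=> D0; apply/matrixP => i j; rewrite mul_trmx_dot mxE.
wlog : i j / (i <= j)%N => [W|].
  by case/orP: (leq_total i j) => /W //; rewrite dot_sym eq_sym.
move: i j; apply: ord3P; apply: ord3P => //= _;
  rewrite ?row0_frame_cd ?row1_frame_cd ?row2_frame_cd;
  move: D0; case: c d => [c1 c2] [d1 d2];
    rewrite dotE !vecZ !vecE /sqnorm !expr2 /= => D0; field => //.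
Qed.

Definition cis (t : R) : R[i] := cos t +i* sin t.
(** The rotations by [s] about the first and the second vector of the base frame,
    lifted to SL2(C) from the identity; the half angles make them [4 pi]-periodic. *)
Definition spin_rot0 (s : R) : 'M[R[i]]_2 := mx22 (cis (- (s / 2))) 0 0 (cis (s / 2)).
Definition spin_rot1 (s : R) : 'M[R[i]]_2 :=
  mx22 (cos (s / 2))%:C (- sin (s / 2))%:C (sin (s / 2))%:C (cos (s / 2))%:C.

Lemma mx22E a b c d : [/\ mx22 a b c d 0 0 = a, mx22 a b c d 0 1 = b,
  mx22 a b c d 1 0 = c & mx22 a b c d 1 1 = d].
Proof. by split; rewrite mxE. Qed.

Lemma ord2P (P : 'I_2 -> Prop) : P 0 -> P 1 -> forall i, P i.
Proof.
move=> P0 P1 [[|[|//]] Hi].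
- by rewrite (_ : Ordinal Hi = 0) //; exact: val_inj.
- by rewrite (_ : Ordinal Hi = 1) //; exact: val_inj.
Qed.

Lemma mx2P g g' : g 0 0 = g' 0 0 -> g 0 1 = g' 0 1 -> g 1 0 = g' 1 0 ->
  g 1 1 = g' 1 1 ->
  g = g'.
Proof. by move=> e1 e2 e3 e4; apply/matrixP; apply: ord2P; apply: ord2P. Qed.

Lemma mulmx2E g g' i j : (g *m g') i j = g i 0 * g' 0 j + g i 1 * g' 1 j.
Proof.
rewrite mxE !big_ord_recl big_ord0 addr0.
by congr (_ * _ + _ * _); congr fun_of_matrix; exact: val_inj.
Qed.

Lemma mul_mx22 g a b c d : g *m mx22 a b c d =
  mx22 (g 0 0 * a + g 0 1 * c) (g 0 0 * b + g 0 1 * d)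
       (g 1 0 * a + g 1 1 * c) (g 1 0 * b + g 1 1 * d).
Proof. by apply: mx2P; rewrite mulmx2E !mxE. Qed.

Lemma mx22_eta g : g = mx22 (g 0 0) (g 0 1) (g 1 0) (g 1 1).
Proof. by apply: mx2P; rewrite mxE. Qed.

Lemma det_mx22 a b c d : \det (mx22 a b c d) = a * d - b * c.
Proof. by rewrite det2; have [-> -> -> ->] := mx22E a b c d. Qed.

Lemma cos_half (s : R) : cos s = cos (s / 2) ^+ 2 - sin (s / 2) ^+ 2.
Proof. by rewrite {1}(splitr s) cosD !expr2. Qed.
Lemma sin_half (s : R) : sin s = 2 * (cos (s / 2) * sin (s / 2)).
Proof. by rewrite {1}(splitr s) sinD mulrC; ring. Qed.

Lemma row3P (F G : 'M[R]_3) : row 0 F = row 0 G -> row 1 F = row 1 G ->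
  row 2 F = row 2 G -> F = G.
Proof. by move=> e0 e1 e2; apply/row_matrixP; apply: ord3P. Qed.

Lemma row_rotate0 (s : R) (F : 'M[R]_3) : [/\ row 0 (rotate 0 s F) = row 0 F,
  row 1 (rotate 0 s F) = cos s *: row 1 F + sin s *: row 2 F &
  row 2 (rotate 0 s F) = cos s *: row 2 F - sin s *: row 1 F].
Proof. by split; rewrite rowK /= ?add0r. Qed.

Lemma row_rotate1 (s : R) (F : 'M[R]_3) : [/\ row 0 (rotate 1 s F) = cos s *: row 0 F
  - sin s *: row 2 F,
  row 1 (rotate 1 s F) = row 1 F &
  row 2 (rotate 1 s F) = cos s *: row 2 F + sin s *: row 0 F].
Proof.
have e2 : 1 + 1 = 2 :> 'I_3 by exact: val_inj.
have e0 : 1 + 2 = 0 :> 'I_3 by exact: val_inj.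
by split; rewrite rowK ?e2 ?e0.
Qed.

Lemma sqnorm_cis (t : R) : sqnorm (cis t) = 1.
Proof. by rewrite /sqnorm /= cos2Dsin2. Qed.

(** The double angle formulas: the frame is quadratic in [(c, d)]. *)
Lemma frame_cd_rot0 c d s : frame_cd (c * cis (- (s / 2))) (d * cis (s / 2)) =
  rotate 0 s (frame_cd c d).
Proof.
have [e0 e1 e2] := row_rotate0 s (frame_cd c d).
have h : cos (s / 2) ^+ 2 + sin (s / 2) ^+ 2 = 1 by rewrite cos2Dsin2.
apply: row3P; rewrite ?(e0, e1, e2) {e0 e1 e2};
  rewrite ?row0_frame_cd ?row1_frame_cd ?row2_frame_cd !sqnormM !sqnorm_cis !mulr1.
- congr (_ *: pt (- (2 * conjc _)) _); rewrite mulrACA -[RHS]mulr1; congr (_ * _).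
  rewrite /cis cosN sinN; apply/eqP; rewrite eq_complex /=; apply/andP; split;
    apply/eqP.
    by rewrite -[RHS]h; ring.
  by ring.
- rewrite (cos_half s) (sin_half s) /cis cosN sinN; case: c d => [c1 c2] [d1 d2].
  by rewrite /pt !vecZ vecD /sqnorm !expr2 /=; congr vec; ring.
- rewrite (cos_half s) (sin_half s) /cis cosN sinN; case: c d => [c1 c2] [d1 d2].
  by rewrite /pt !vecZ vecB /sqnorm !expr2 /=; congr vec; ring.
Qed.

Lemma sqnorm_rot (C S : R) c d : C ^+ 2 + S ^+ 2 = 1 ->
  sqnorm (c * C%:C + d * S%:C) + sqnorm (c * (- S)%:C + d * C%:C) = sqnorm c + sqnorm d.
Proof.
move=> h; case: c d => [c1 c2] [d1 d2]; rewrite -[RHS]mulr1 -[X in _ = _ * X]h /sqnorm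
  /=; ring.
Qed.

Lemma frame_cd_rot1 c d s :
  frame_cd (c * (cos (s / 2))%:C + d * (sin (s / 2))%:C)
         (c * (- sin (s / 2))%:C + d * (cos (s / 2))%:C) =
  rotate 1 s (frame_cd c d).
Proof.
have [e0 e1 e2] := row_rotate1 s (frame_cd c d).
have h : cos (s / 2) ^+ 2 + sin (s / 2) ^+ 2 = 1 by rewrite cos2Dsin2.
apply: row3P; rewrite ?(e0, e1, e2) {e0 e1 e2};
  rewrite ?row0_frame_cd ?row1_frame_cd ?row2_frame_cd !sqnorm_rot //.
- rewrite (cos_half s) (sin_half s); case: c d => [c1 c2] [d1 d2].
  by rewrite /pt !vecZ vecB /sqnorm !expr2 /=; congr vec; ring.
- congr (_ *: _); rewrite /pt -[vec _ _ _ in RHS]scale1r -[X in X *: _]h vecZ.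
  by case: c d => [c1 c2] [d1 d2]; rewrite !expr2 /=; congr vec; ring.
- rewrite (cos_half s) (sin_half s); case: c d => [c1 c2] [d1 d2].
  by rewrite /pt !vecZ vecD /sqnorm !expr2 /=; congr vec; ring.
Qed.

Lemma point_abcd_rot0 a b c d s :
  point_abcd (a * cis (- s)) (b * cis s) (c * cis (- s)) (d * cis s) = point_abcd a b
    c d.
Proof.
rewrite /point_abcd !sqnormM !sqnorm_cis !mulr1; congr (_ *: pt _ _).
rewrite !rmorphM /= mulrACA [X in _ + X]mulrACA -!sqnormE !sqnorm_cis.
by rewrite !mulr1.
Qed.

Lemma point_abcd_rot1 a b c d (C S : R) : C ^+ 2 + S ^+ 2 = 1 ->
  point_abcd (a * C%:C + b * S%:C) (a * (- S)%:C + b * C%:C)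
         (c * C%:C + d * S%:C) (c * (- S)%:C + d * C%:C) = point_abcd a b c d.
Proof.
move=> h; rewrite /point_abcd sqnorm_rot //; congr (_ *: pt _ _).
rewrite -[RHS]mulr1 -(rmorph1 (real_complex R)) -h.
case: a b c d => [a1 a2] [b1 b2] [c1 c2] [d1 d2].
by apply/eqP; rewrite eq_complex /=; apply/andP; split; apply/eqP; ring.
Qed.

End Rotations.

(** * Lifting paths of frames to paths of spin frames *)

Section Lifting.
Variable R : realType.
Implicit Types (p : 'rV[R]_3) (a b c d z : R[i]) (g : 'M[R[i]]_2).

Lemma continuous_Re : continuous (@complex.Re R : R[i] -> R).
Proof.
move=> z A /nbhs_ballP[e e0 zA].
exists e%:C => /=; first by rewrite ltcR.
move=> w; rewrite /ball_ /= normc_def ltcR => h; apply: zA; rewrite /ball /=.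
apply: le_lt_trans h; rewrite -sqrtr_sqr ler_sqrt ?addr_ge0 ?sqr_ge0 //.
by case: z w => [x y] [x' y'] /=; rewrite lerDl sqr_ge0.
Qed.

Lemma continuous_Im : continuous (@complex.Im R : R[i] -> R).
Proof.
move=> z A /nbhs_ballP[e e0 zA].
exists e%:C => /=; first by rewrite ltcR.
move=> w; rewrite /ball_ /= normc_def ltcR => h; apply: zA; rewrite /ball /=.
apply: le_lt_trans h; rewrite -sqrtr_sqr ler_sqrt ?addr_ge0 ?sqr_ge0 //.
by case: z w => [x y] [x' y'] /=; rewrite lerDr sqr_ge0.
Qed.

Lemma continuous_entry (i j : 'I_2) : continuous (fun M : 'M[R[i]]_2 => M i j).
Proof. move=> M; apply: coord_continuous. Qed.

Lemma continuous_mx (T : topologicalType) (f : T -> 'M[R[i]]_2) x :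
  (forall i j, {for x, continuous (fun s => f s i j)}) -> {for x, continuous f}.
Proof.
move=> fc; apply/cvg_mx_entourageP => A entA.
apply: filter_forall => i; apply: filter_forall => j.
have /cvg_entourageP/(_ A entA) h := fc i j.
change (\forall s \near x, (f x i j, f s i j) \in A).
have {}h : \forall s \near x, A (f x i j, f s i j) := h.
by near=> s; rewrite inE; near: s.
Unshelve. all: by end_near.
Qed.

Lemma continuous_mx22 (T : topologicalType) (a b c d : T -> R[i]) x :
  {for x, continuous a} -> {for x, continuous b} -> {for x, continuous c} ->
  {for x, continuous d} -> {for x, continuous (fun s => mx22 (a s) (b s) (c s) (d s))}.
Proof.
move=> ca cb cc cd; apply: continuous_mx.
have e00 : (fun s => mx22 (a s) (b s) (c s) (d s) 0 0) = a by apply/funext => t;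
  rewrite mxE.
have e01 : (fun s => mx22 (a s) (b s) (c s) (d s) 0 1) = b by apply/funext => t;
  rewrite mxE.
have e10 : (fun s => mx22 (a s) (b s) (c s) (d s) 1 0) = c by apply/funext => t;
  rewrite mxE.
have e11 : (fun s => mx22 (a s) (b s) (c s) (d s) 1 1) = d by apply/funext => t;
  rewrite mxE.
by apply: ord2P; apply: ord2P; rewrite ?(e00, e01, e10, e11).
Qed.

Lemma continuous_cplx (T : topologicalType) (u v : T -> R) x :
  {for x, continuous u} -> {for x, continuous v} ->
    {for x, continuous (fun s => u s +i* v s)}.
Proof.
move=> cu cv A [[e1 e2] /=].
rewrite ltcE /= => /andP[/eqP-> e0] eA.
have e20 : 0 < e1 / 2 by rewrite divr_gt0.
have hu := (@cvgrPdist_lt _ _ _ _ _ _ _).1 cu _ e20;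
  have hv := (@cvgrPdist_lt _ _ _ _ _ _ _).1 cv _ e20.
have {}hu := hu (nbhs_filter x); have {}hv := hv (nbhs_filter x).
change (\forall s \near x, A (u s +i* v s)).
near=> s; apply: eA; rewrite /ball_ /= normc_def ltcR /=.
have a : `|u x - u s| < e1 / 2 by near: s.
have b : `|v x - v s| < e1 / 2 by near: s.
rewrite -(ltr_pXn2r (n:=2)) ?nnegrE ?sqrtr_ge0 ?ltW // sqr_sqrtr ?addr_ge0 ?sqr_ge0 //.
rewrite -(real_normK (num_real (u x - u s))) -(real_normK (num_real (v x - v s))).
have := normr_ge0 (u x - u s); have := normr_ge0 (v x - v s); nra.
Unshelve. all: by end_near. Qed.


Lemma continuous_realc (T : topologicalType) (u : T -> R) x :
  {for x, continuous u} -> {for x, continuous (fun s => (u s)%:C)}.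
Proof.
move=> cu; apply: (@continuous_cplx T u (fun=> 0) x cu).
exact: (@cst_continuous T R 0 x).
Qed.

Lemma continuous_cD (T : topologicalType) (f g : T -> R[i]) x :
  {for x, continuous f} -> {for x, continuous g} ->
    {for x, continuous (fun y => f y + g y)}.
Proof. by move=> cf cg; exact: (@cvgD R[i] R[i]^o T (nbhs x) _ f g _ _ cf cg). Qed.

Lemma continuous_cM (T : topologicalType) (f g : T -> R[i]) x :
  {for x, continuous f} -> {for x, continuous g} ->
    {for x, continuous (fun y => f y * g y)}.
Proof. by move=> cf cg; exact: (@cvgM R[i] T (nbhs x) _ f g _ _ cf cg). Qed.

Lemma continuous_cN (T : topologicalType) (f : T -> R[i]) x :
  {for x, continuous f} -> {for x, continuous (fun y => - f y)}.
Proof. by move=> cf; exact: (@cvgN R[i] R[i]^o T (nbhs x) _ f _ cf). Qed.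

Lemma point_abcd_tc a b c d : tc (point_abcd a b c d) = (sqnorm c + sqnorm d)^-1.
Proof. by rewrite /tc mxE vec2 mulr1. Qed.
Lemma zc_pt z (t : R) : zc (pt z t) = z.
Proof. by rewrite /pt zc_vec; case: z. Qed.
Lemma tc_pt z (t : R) : tc (pt z t) = t.
Proof. by rewrite /pt tc_vec. Qed.
Lemma pt_inj z z' (t t' : R) : pt z t = pt z' t' -> z = z' /\ t = t'.
Proof. by move=> e; split; [rewrite -(zc_pt z t) e zc_pt | rewrite -(tc_pt z t) e
  tc_pt]. Qed.

(** Given the second row and the point, the equation [ad - bc = 1] is linear in
    [(a, b)], so that the first row can be recovered. *)
Lemma first_row_of_point a b c d : a * d - b * c = 1 ->
  let N := a * c^* + b * d^* in
  (a * (sqnorm c + sqnorm d)%:C = c * N + d^*) *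
  (b * (sqnorm c + sqnorm d)%:C = d * N - c^*).
Proof.
move=> h N; rewrite rmorphD /= !sqnormE; split.
- by rewrite -[d^* in RHS]mul1r -h /N; ring.
- by rewrite -[c^* in RHS]mul1r -h /N; ring.
Qed.

(** The fibre of the double cover.  The frame gives [c^2], [d^2] and [cd], hence
    [(c, d)] up to sign, and the point then gives the first row. *)
Lemma spin_frame_determined g g' : \det g = 1 -> \det g' = 1 ->
  point_of g = point_of g' -> frame_of g = frame_of g' -> g' = g \/ g' = - g.
Proof.
move=> dg dg'; rewrite !point_ofE !frame_ofE // => ep ef.
have eD : sqnorm (g 1 0) + sqnorm (g 1 1) = sqnorm (g' 1 0) + sqnorm (g' 1 1).
  by have := congr1 (@tc R) ep; rewrite !point_abcd_tc => /invr_inj.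
have D0 : (sqnorm (g 1 0) + sqnorm (g 1 1))%:C != 0 :> R[i].
  by rewrite fmorph_eq0 gt_eqF ?sqnorm2_gt0.
have D20 : (sqnorm (g 1 0) + sqnorm (g 1 1)) ^- 2 != 0 :> R.
  by rewrite invr_neq0 // expf_neq0 // gt_eqF // sqnorm2_gt0.
have [eN _] : g 0 0 * (g 1 0)^* + g 0 1 * (g 1 1)^* =
              g' 0 0 * (g' 1 0)^* + g' 0 1 * (g' 1 1)^* /\ (1 : R) = 1.
  apply: pt_inj; apply/(scalerI (a := (sqnorm (g 1 0) + sqnorm (g 1 1))^-1)).
    by move: D20; rewrite -exprVn expf_eq0.
  by move: ep; rewrite /point_abcd -eD.
have [e0 e1 e2] : [/\ g 1 0 * g 1 1 = g' 1 0 * g' 1 1,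
    g 1 0 ^+ 2 = g' 1 0 ^+ 2 & g 1 1 ^+ 2 = g' 1 1 ^+ 2].
  have := congr1 (row 0) ef; have := congr1 (row 1) ef; have := congr1 (row 2) ef.
  rewrite !row0_frame_cd !row1_frame_cd !row2_frame_cd -eD.
  move=> /(scalerI D20)/pt_inj[+ _] /(scalerI D20)/pt_inj[+ _] /(scalerI D20)/pt_inj[+
    _].
  have i0 : (0 +i* 1 : R[i]) != 0 by rewrite eq_complex /= oner_eq0 andbF.
  have n2 : (2 : R[i]) != 0 by rewrite pnatr_eq0.
  move=> e2 /(mulfI i0) e1 /oppr_inj/(mulfI n2) e0.
  split; apply: (can_inj (@conjcK R)) => //; rewrite !rmorphXn /=; apply: (mulfI n2).
  - transitivity (((g 1 0)^* ^+ 2 + (g 1 1)^* ^+ 2) - ((g 1 1)^* ^+ 2 - (g 1 0)^* ^+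
      2)); first by ring.
    by rewrite e1 e2; ring.
  - transitivity (((g 1 0)^* ^+ 2 + (g 1 1)^* ^+ 2) +
      ((g 1 1)^* ^+ 2 - (g 1 0)^* ^+ 2)); first by ring.
    by rewrite e1 e2; ring.
have [ea eb] := first_row_of_point (etrans (esym (det2 g)) dg).
have [ea' eb'] := first_row_of_point (etrans (esym (det2 g')) dg').
have same (e : R[i]) : e ^+ 2 = 1 -> e^* = e -> g' 1 0 = e * g 1 0 ->
  g' 1 1 = e * g 1 1 -> g' = e *: g.
  move=> e1' eJ ec ed.
  apply: mx2P; rewrite mxE //; apply: (mulIf D0).
  - by rewrite {1}eD ea' -mulrA ea -eN ec ed rmorphM /= eJ; ring.
  - by rewrite {1}eD eb' -mulrA eb -eN ec ed rmorphM /= eJ; ring.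
have [c0|c0] := eqVneq (g 1 0) 0.
  have c0' : g' 1 0 = 0 by apply/eqP; rewrite -sqrf_eq0 -e1 c0 expr0n.
  move/eqP: e2; rewrite eqf_sqr => /orP[/eqP h|/eqP h]; [left|right].
  - by rewrite -[RHS]scale1r; apply: same;
      rewrite ?expr1n ?rmorph1 ?c0' ?c0 ?mulr0 ?h ?mul1r.
  - rewrite -scaleN1r; apply: same; rewrite ?sqrrN ?expr1n ?rmorphN ?rmorph1 ?c0' ?c0
      ?mulr0 ?h ?mulN1r ?opprK //.
move/eqP: e1; rewrite eqf_sqr => /orP[/eqP h|/eqP h]; [left|right].
- have ed : g' 1 1 = g 1 1 by apply: (mulfI c0); rewrite e0 h.
  by rewrite -[RHS]scale1r; apply: same; rewrite ?expr1n ?rmorph1 ?mul1r.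
- have ed : g' 1 1 = - g 1 1 by apply: (mulfI c0); rewrite mulrN e0 h mulNr.
  by rewrite -scaleN1r; apply: same; rewrite ?sqrrN ?expr1n ?rmorphN ?rmorph1 ?mulN1r
    ?h ?opprK.
Qed.

(** The real inner product of [P s] with [Q s] is continuous and, being the squared
    length of [Q s] up to sign, never vanishes; by the intermediate value theorem it
    keeps its sign. *)
Lemma continuous_lift_unique (P Q : R -> 'M[R[i]]_2) s0 :
  continuous P -> continuous Q -> (forall s, \det (Q s) = 1) ->
  (forall s, P s = Q s \/ P s = - Q s) -> P s0 = Q s0 -> P =1 Q.
Proof.
move=> cP cQ dQ PQ e0 s1.
pose ip g g' : R := \sum_i \sum_j (Re (g i j) * Re (g' i j) + Im (g i j) * Im (g' i j)).
have ipN g g' : ip (- g) g' = - ip g g'.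
  by rewrite /ip -sumrN; apply: eq_bigr => i _; rewrite -sumrN; apply: eq_bigr => j _;
    rewrite mxE; case: (g i j) => x y /=; ring.
have ip0 g : \det g = 1 -> 0 < ip g g.
  move=> dg; rewrite lt_def sumr_ge0 ?andbT; last by move=> i _;
    rewrite sumr_ge0 // => j _; rewrite addr_ge0 // -expr2 sqr_ge0.
  apply/eqP => h; have g0 i j : g i j = 0.
    have nn k l : 0 <= Re (g k l) * Re (g k l) + Im (g k l) * Im (g k l).
      by rewrite addr_ge0 // -expr2 sqr_ge0.
    apply/eqP; rewrite -sqnorm_eq0 /sqnorm !expr2.
    have := @psumr_eq0P _ _ predT _ (fun k _ => sumr_ge0 _ (fun l _ => nn k l)) h i isT.
    by move/(@psumr_eq0P _ _ predT _ (fun l _ => nn i l))/(_ j isT)/eqP.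
  by move: dg; rewrite det2 !g0 !mulr0 subrr => /esym/eqP; rewrite oner_eq0.
pose f s := ip (P s) (Q s).
have cf : continuous f.
  have ce (M : R -> 'M[R[i]]_2) i j : continuous M ->
      continuous (fun s => Re (M s i j)) /\ continuous (fun s => Im (M s i j)).
    move=> cM; split=> s.
      apply: (@continuous_comp _ _ _ (fun s => M s i j) (@complex.Re R));
        last exact: continuous_Re.
      by apply: (@continuous_comp _ _ _ M (fun N => N i j));
        [exact: cM|exact: continuous_entry].
    apply: (@continuous_comp _ _ _ (fun s => M s i j) (@complex.Im R));
      last exact: continuous_Im.
    by apply: (@continuous_comp _ _ _ M (fun N => N i j));
      [exact: cM|exact: continuous_entry].
  apply: continuous_big => [|i _]; first exact: add_continuous.
  apply: continuous_big => [|j _ s]; first exact: add_continuous.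
  have [pr pi] := ce P i j cP; have [qr qi] := ce Q i j cQ.
  by apply: cvgD; apply: cvgM; [exact: pr|exact: qr|exact: pi|exact: qi].
have f0 s : f s = 0 -> False.
  by rewrite /f; case: (PQ s) => ->; rewrite ?ipN => /eqP;
    rewrite ?oppr_eq0 gt_eqF ?ip0.
case: (PQ s1) => // e1.
have fs0 : 0 < f s0 by rewrite /f e0 ip0.
have fs1 : f s1 < 0 by rewrite /f e1 ipN oppr_lt0 ip0.
have [le01|le10] := leP s0 s1.
  have [|x _ /f0//] := @IVT R f s0 s1 0 le01 (continuous_subspaceT cf).
  by rewrite ge_min le_max (ltW fs1) (ltW fs0) orbT.
have [|x _ /f0//] := @IVT R f s1 s0 0 (ltW le10) (continuous_subspaceT cf).
by rewrite ge_min le_max (ltW fs1) (ltW fs0) orbT.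
Qed.


Lemma spin_path_unique (P Q : R -> 'M[R[i]]_2) s0 : continuous P -> continuous Q ->
  (forall s, \det (P s) = 1) -> (forall s, \det (Q s) = 1) ->
  (forall s, point_of (P s) = point_of (Q s)) ->
  (forall s, frame_of (P s) = frame_of (Q s)) -> P s0 = Q s0 -> P =1 Q.
Proof.
move=> cP cQ dP dQ ep ef; apply: continuous_lift_unique => // s.
by case: (spin_frame_determined (dQ s) (dP s) (esym (ep s)) (esym (ef s)));
  [left|right].
Qed.

Lemma continuous_cst_mul22 g (a b c d : R -> R[i]) :
  continuous a -> continuous b -> continuous c -> continuous d ->
  continuous (fun s => g *m mx22 (a s) (b s) (c s) (d s)).
Proof.
move=> ca cb cc cd s.
rewrite (_ : (fun s => _) = fun s => mx22 (g 0 0 * a s + g 0 1 * c s) (g 0 0 * b s +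
  g 0 1 * d s)
       (g 1 0 * a s + g 1 1 * c s) (g 1 0 * b s + g 1 1 * d s)); last first.
  by apply/funext => x; rewrite mul_mx22.
have h (u v : R -> R[i]) (x y : R[i]) : continuous u -> continuous v ->
    {for s, continuous (fun s => x * u s + y * v s)}.
  move=> cu cv; apply: continuous_cD; apply: continuous_cM;
    by [exact: cst_continuous | exact: cu | exact: cv].
exact: (continuous_mx22 (h a c (g 0 0) (g 0 1) ca cc) (h b d (g 0 0) (g 0 1) cb cd)
  (h a c (g 1 0) (g 1 1) ca cc) (h b d (g 1 0) (g 1 1) cb cd)).
Qed.

Lemma det_spin_rot0 (s : R) : \det (spin_rot0 s) = 1.
Proof.
rewrite /spin_rot0 det_mx22 mulr0 subr0 /cis cosN sinN.
apply/eqP; rewrite eq_complex /=; apply/andP; split; apply/eqP; last by ring.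
by rewrite -[RHS](cos2Dsin2 (s / 2)); ring.
Qed.

Lemma det_spin_rot1 (s : R) : \det (spin_rot1 s) = 1.
Proof.
rewrite /spin_rot1 det_mx22 -!rmorphM -rmorphB /= -[RHS](rmorph1 (real_complex R)).
by congr _%:C; rewrite -[RHS](cos2Dsin2 (s / 2)); ring.
Qed.

Lemma mul_spin_rot0 g (t : R) : g *m spin_rot0 t =
  mx22 (g 0 0 * cis (- (t / 2))) (g 0 1 * cis (t / 2)) (g 1 0 * cis (- (t / 2))) (g 1
    1 * cis (t / 2)).
Proof. by rewrite mul_mx22 !mulr0 !addr0 !add0r. Qed.

Lemma point_of_rot0 g (t : R) : point_of (g *m spin_rot0 t) = point_of g.
Proof. by rewrite !point_ofE mul_spin_rot0 !mxE /= point_abcd_rot0. Qed.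

Lemma point_of_rot1 g (t : R) : point_of (g *m spin_rot1 t) = point_of g.
Proof.
by rewrite !point_ofE /spin_rot1 mul_mx22 !mxE /= point_abcd_rot1 // cos2Dsin2.
Qed.

Lemma frame_of_rot0 g (t : R) : \det g = 1 ->
  frame_of (g *m spin_rot0 t) = rotate 0 t (frame_of g).
Proof.
move=> dg; have dt : \det (g *m spin_rot0 t) = 1.
  by rewrite det_mulmx dg det_spin_rot0 mulr1.
by rewrite !frame_ofE // mul_spin_rot0 !mxE /= frame_cd_rot0.
Qed.

Lemma frame_of_rot1 g (t : R) : \det g = 1 ->
  frame_of (g *m spin_rot1 t) = rotate 1 t (frame_of g).
Proof.
move=> dg; have dt : \det (g *m spin_rot1 t) = 1.
  by rewrite det_mulmx dg det_spin_rot1 mulr1.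
by rewrite !frame_ofE // /spin_rot1 mul_mx22 !mxE /= frame_cd_rot1.
Qed.

Lemma spin_rotation_unique k (s : R) g g1 g2 :
  spin_rotation k s g g1 -> spin_rotation k s g g2 -> g1 = g2.
Proof.
move=> [P [cP P0 <- hP]] [Q [cQ Q0 <- hQ]].
apply: (@spin_path_unique P Q 0 cP cQ) => [t|t|t|t|].
- by have [+ _ _] := hP t; rewrite inE.
- by have [+ _ _] := hQ t; rewrite inE.
- by have [_ -> _] := hP t; have [_ -> _] := hQ t.
- by have [_ _ ->] := hP t; have [_ _ ->] := hQ t.
- by rewrite P0 Q0.
Qed.

Lemma continuous_half : continuous (fun s : R => s / 2).
Proof. by move=> s; apply: cvgM; [exact: cvg_id|exact: cvg_cst]. Qed.
Lemma continuous_cos_half : continuous (fun s : R => cos (s / 2)).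
Proof.
move=> s; apply: (@continuous_comp _ _ _ (fun s : R => s / 2) cos).
  exact: continuous_half.
exact: continuous_cos.
Qed.
Lemma continuous_sin_half : continuous (fun s : R => sin (s / 2)).
Proof.
move=> s; apply: (@continuous_comp _ _ _ (fun s : R => s / 2) sin).
  exact: continuous_half.
exact: continuous_sin.
Qed.

Lemma spin_rotation0 (s : R) g : \det g = 1 -> spin_rotation 0 s g (g *m spin_rot0 s).
Proof.
move=> dg; exists (fun t => g *m spin_rot0 t); split => //.
- apply: continuous_cst_mul22 => t; try exact: cvg_cst.
    apply: continuous_cplx.
      have -> : (fun u : R => cos (- (u / 2))) = fun u => cos (u / 2)
        by apply/funext => u; rewrite cosN.
      exact: continuous_cos_half.
    have -> : (fun u : R => sin (- (u / 2))) = fun u => - sin (u / 2)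
      by apply/funext => u; rewrite sinN.
    apply: continuousN; exact: continuous_sin_half.
  by apply: continuous_cplx; [exact: continuous_cos_half|exact: continuous_sin_half].
- by rewrite mul_spin_rot0 mul0r oppr0 /cis cos0 sin0 !mulr1 -mx22_eta.
move=> t; split; last exact: frame_of_rot0.
  by rewrite inE /spin_frame /= det_mulmx dg det_spin_rot0 mulr1.
exact: point_of_rot0.
Qed.

Lemma spin_rotation1 (s : R) g : \det g = 1 -> spin_rotation 1 s g (g *m spin_rot1 s).
Proof.
move=> dg; exists (fun t => g *m spin_rot1 t); split => //.
- apply: continuous_cst_mul22 => t.
  + by apply: (@continuous_realc R (fun s => cos (s / 2)) t);
      exact: continuous_cos_half.
  + apply: (@continuous_realc R (fun s => - sin (s / 2)) t).
    by apply: continuousN; exact: continuous_sin_half.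
  + by apply: (@continuous_realc R (fun s => sin (s / 2)) t);
      exact: continuous_sin_half.
  + by apply: (@continuous_realc R (fun s => cos (s / 2)) t);
      exact: continuous_cos_half.
- rewrite /spin_rot1 mul0r cos0 sin0 oppr0 mul_mx22.
  by rewrite !mulr0 !addr0 !add0r !mulr1 -mx22_eta.
move=> t; split; last exact: frame_of_rot1.
  by rewrite inE /spin_frame /= det_mulmx dg det_spin_rot1 mulr1.
exact: point_of_rot1.
Qed.

End Lifting.

(** * Parallel transport *)

Section Parallel.
Variable R : realType.
Implicit Types (p : 'rV[R]_3) (a b c d z : R[i]) (g h : 'M[R[i]]_2).

Lemma is_deriveMR (f g : R -> R) (s df dg : R) :
  is_derive s 1 f df -> is_derive s 1 g dg ->
  is_derive s 1 (fun x => f x * g x) (df * g s + f s * dg).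
Proof.
move=> Hf Hg; have := @is_deriveM _ _ f g s 1 _ _ Hf Hg.
by move/is_derive_eq; apply; rewrite /GRing.scale /=; ring.
Qed.

Lemma is_deriveDR (f g : R -> R) (s df dg : R) :
  is_derive s 1 f df -> is_derive s 1 g dg ->
  is_derive s 1 (fun x => f x + g x) (df + dg).
Proof. by move=> Hf Hg; exact: (@is_deriveD _ _ _ f g s 1). Qed.

Lemma is_deriveBR (f g : R -> R) (s df dg : R) :
  is_derive s 1 f df -> is_derive s 1 g dg ->
  is_derive s 1 (fun x => f x - g x) (df - dg).
Proof. by move=> Hf Hg; exact: (@is_deriveB _ _ _ f g s 1). Qed.

Lemma is_derive_dot (Y Z : R -> 'rV[R]_3) (s : R) dY dZ :
  is_derive s 1 Y dY -> is_derive s 1 Z dZ ->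
  is_derive s 1 (fun x => dot (Y x) (Z x)) (dot dY (Z s) + dot (Y s) dZ).
Proof.
move=> HY HZ; have hY := is_derive_coord _ HY; have hZ := is_derive_coord _ HZ.
have -> : (fun x => dot (Y x) (Z x)) =
  fun x => Y x 0 0 * Z x 0 0 + Y x 0 1 * Z x 0 1 + Y x 0 2 * Z x 0 2.
  by apply/funext => x; rewrite dotE.
have h j := is_deriveMR (hY j) (hZ j).
have := is_deriveDR (is_deriveDR (h 0) (h 1)) (h 2).
by move/is_derive_eq; apply; rewrite !dotE; ring.
Qed.

(** Parallel transport along a curve through [p] with velocity [X], solved for the
    derivative of the transported vector [Y]. *)
Definition transport_rhs (p X Y : 'rV[R]_3) : 'rV[R]_3 :=
  (tc p)^-1 *: (tc X *: Y + tc Y *: X - dot X Y *: vec 0 0 1).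

Lemma transport_rhsE (p X Y : 'rV[R]_3) j : transport_rhs p X Y 0 j =
  (tc p)^-1 * (tc X * Y 0 j + tc Y * X 0 j - dot X Y * vec 0 0 1 0 j).
Proof. by rewrite /transport_rhs; set e := vec 0 0 1; rewrite !mxE. Qed.

Lemma parallel_alongP (c Y X : R -> 'rV[R]_3) : (forall s : R, is_derive s 1 c (X s)) ->
  parallel_along c Y <-> forall s : R, is_derive s 1 Y (transport_rhs (c s) (X s) (Y
    s)).
Proof.
move=> HX; have eX s : derive1 c s = X s by rewrite derive1E (@derive_val _ _ _ _ _ _
  _ (HX s)).
split=> H s.
- have [dY] := H s; rewrite /cov eX => /eqP; rewrite subr_eq0 => /eqP eY.
  by split=> //; rewrite -derive1E eY.
- have [dY eY] := H s; split=> //; rewrite /cov eX derive1E eY; exact: subrr.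
Qed.

(** The hyperbolic inner product is the Euclidean one divided by [t^2], and the
    connection is metric. *)
Lemma parallel_dot_const (c X Y Z : R -> 'rV[R]_3) :
  (forall s : R, is_derive s 1 c (X s)) ->
  (forall s, 0 < tc (c s)) -> parallel_along c Y -> parallel_along c Z ->
  forall s s', dot (Y s) (Z s) / tc (c s) ^+ 2 = dot (Y s') (Z s') / tc (c s') ^+ 2.
Proof.
move=> HX t0 /(parallel_alongP _ HX) HY /(parallel_alongP _ HX) HZ s s'.
apply: (@is_derive_0_is_cst _ (fun s => dot (Y s) (Z s) / tc (c s) ^+ 2)) => x.
have Ht : is_derive x 1 (fun s => tc (c s)) (X x 0 2) by exact: is_derive_coord.
have n0 : tc (c x) ^+ 2 != 0 by rewrite expf_neq0 // gt_eqF.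
have := is_derive_quot (f := fun s => dot (Y s) (Z s)) (g := fun s => tc (c s) ^+ 2) n0
  (is_derive_dot (HY x) (HZ x)) (is_deriveMR Ht Ht).
move/is_derive_eq; apply; apply/eqP; rewrite mulf_eq0; apply/orP; left; apply/eqP.
have {}n0 : tc (c x) != 0 by rewrite gt_eqF.
rewrite /transport_rhs !dotE !mxE /= /tc; move: n0; rewrite /tc => n0; field => //.
Qed.

Lemma point_det g : \det g = 1 -> 0 < tc (point_of g).
Proof. by move=> dg; rewrite point_ofE point_abcd_tc invr_gt0 sqnorm2_gt0. Qed.

Lemma frame_orthonormal g : \det g = 1 ->
  frame_of g *m (frame_of g)^T = (tc (point_of g) ^+ 2)%:M.
Proof.
move=> dg; rewrite frame_ofE // point_ofE point_abcd_tc exprVn.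
by apply: frame_cd_orthonormal; rewrite gt_eqF ?sqnorm2_gt0.
Qed.

Lemma trmx_orthonormal (F : 'M[R]_3) (tau : R) : tau != 0 ->
  F *m F^T = tau%:M -> F^T *m F = tau%:M.
Proof.
move=> tau0 FF.
have : F *m (tau^-1 *: F^T) = 1%:M by rewrite -scalemxAr FF scale_scalar_mx mulVf.
move/mulmx1C; rewrite -scalemxAl => /(congr1 (fun M => tau *: M)).
by rewrite scalerA divff // scale1r scale_scalar_mx mulr1.
Qed.

(** The matrix of inner products of the two frames is constant, so frames that agree
    once agree always; the spin lifts then agree by continuity. *)
Lemma spin_parallel_unique (c X : R -> 'rV[R]_3) (P Q : R -> 'M[R[i]]_2) s0 :
  (forall s : R, is_derive s 1 c (X s)) ->
  spin_parallel_along c P -> spin_parallel_along c Q -> P s0 = Q s0 -> P =1 Q.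
Proof.
move=> HX [cP hP pP] [cQ hQ pQ] e0.
have dP s : \det (P s) = 1 by have [+ _] := hP s; rewrite inE.
have dQ s : \det (Q s) = 1 by have [+ _] := hQ s; rewrite inE.
have eP s : point_of (P s) = c s by have [] := hP s.
have eQ s : point_of (Q s) = c s by have [] := hQ s.
have t0 s : 0 < tc (c s) by rewrite -eP point_det.
apply: (spin_path_unique cP cQ dP dQ _ _ e0) => s; first by rewrite eP eQ.
have n0 : tc (c s) ^+ 2 != 0 by rewrite expf_neq0 // gt_eqF.
have PQ : frame_of (P s) *m (frame_of (Q s))^T = (tc (c s) ^+ 2)%:M.
  apply/matrixP => i j; rewrite mul_trmx_dot.
  apply: (mulIf (_ : (tc (c s) ^+ 2)^-1 != 0)); first by rewrite invr_eq0.
  rewrite (parallel_dot_const HX t0 (pP i) (pQ j) s s0) e0 -mul_trmx_dot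
    frame_orthonormal // eQ.
  by rewrite !mxE !mulrnAl !divff // expf_neq0 // gt_eqF.
have QQ : frame_of (Q s) *m (frame_of (Q s))^T = (tc (c s) ^+ 2)%:M.
  by rewrite frame_orthonormal ?eQ.
have QQ' := trmx_orthonormal n0 QQ.
have : frame_of (P s) *m ((frame_of (Q s))^T *m frame_of (Q s)) = tc (c s) ^+ 2 *:
  frame_of (Q s).
  by rewrite mulmxA PQ mul_scalar_mx.
by rewrite QQ' mul_mx_scalar => /(scalerI n0).
Qed.


(** Its conjugates move points along geodesics with unit speed; on the base frame
    it moves in the direction of the first vector, which points down. *)
Definition boost (s : R) : 'M[R[i]]_2 := 
  mx22 (expR (- (s / 2)))%:C 0 0 (expR (s / 2))%:C.

Lemma det_boost s : \det (boost s) = 1.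
Proof. by rewrite det_mx22 mulr0 subr0 -rmorphM /= -expRD addNr expR0. Qed.

Lemma mul_boost g (s : R) : g *m boost s =
  mx22 (g 0 0 * (expR (- (s / 2)))%:C) (g 0 1 * (expR (s / 2))%:C)
       (g 1 0 * (expR (- (s / 2)))%:C) (g 1 1 * (expR (s / 2))%:C).
Proof. by rewrite mul_mx22 !mulr0 !addr0 !add0r. Qed.

Lemma expR_half (s : R) : (expR (s / 2) ^+ 2 = expR s).
Proof. by rewrite expr2 -expRD -splitr. Qed.

(** The inverse of the third coordinate of the moving point. *)
Definition inv_height (c d : R[i]) (s : R) : R :=
  sqnorm c * expR (- s) + sqnorm d * expR s.

Lemma sqnorm_boost c d s :
  sqnorm (c * (expR (- (s / 2)))%:C) + sqnorm (d * (expR (s / 2))%:C) = inv_height c d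
    s.
Proof.
rewrite !sqnormM /inv_height; congr (_ * _ + _ * _); rewrite /sqnorm /= expr0n addr0.
  by rewrite -mulNr expR_half.
by rewrite expR_half.
Qed.

(** All coordinates of a boosted point or frame become such combinations after
    multiplication by a power of [inv_height]. *)
Definition exp_comb (k0 k1 k2 s : R) : R := k0 + k1 * expR (- s) + k2 * expR s.

Section Rows.
Variables c1 c2 d1 d2 : R.
Let c := c1 +i* c2.
Let d := d1 +i* d2.
Let F (s : R) := frame_cd (c * (expR (- (s / 2)))%:C) (d * (expR (s / 2))%:C).

Lemma row0_boost s : row 0 (F s) = inv_height c d s ^- 2 *:
  vec (exp_comb (- (2 * (c1 * d1 - c2 * d2))) 0 0 s) (exp_comb (2 * (c1 * d2 +
    c2 * d1)) 0 0 s)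
      (exp_comb 0 (c1 ^+ 2 + c2 ^+ 2) (- (d1 ^+ 2 + d2 ^+ 2)) s).
Proof.
rewrite row0_frame_cd sqnorm_boost /exp_comb.
have pq : expR (- (s / 2)) * expR (s / 2) = 1 :> R by rewrite -expRD addNr expR0.
rewrite -(expR_half s) -(expR_half (- s)) mulNr.
move: (expR (s / 2)) (expR (- (s / 2))) pq => q p pq.
by congr (_ *: _); rewrite /c /d /sqnorm /pt ?expr2 /=; congr vec; ring: pq.
Qed.

Lemma row1_boost s : row 1 (F s) = inv_height c d s ^- 2 *:
  vec (exp_comb 0 (2 * (c1 * c2)) (2 * (d1 * d2)) s)
      (exp_comb 0 (c1 ^+ 2 - c2 ^+ 2) (d1 ^+ 2 - d2 ^+ 2) s)
      (exp_comb (2 * (c2 * d1 - c1 * d2)) 0 0 s).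
Proof.
rewrite row1_frame_cd sqnorm_boost /exp_comb.
have pq : expR (- (s / 2)) * expR (s / 2) = 1 :> R by rewrite -expRD addNr expR0.
rewrite -(expR_half s) -(expR_half (- s)) mulNr.
move: (expR (s / 2)) (expR (- (s / 2))) pq => q p pq.
by congr (_ *: _); rewrite /c /d /sqnorm /pt ?expr2 /=; congr vec; ring: pq.
Qed.

Lemma row2_boost s : row 2 (F s) = inv_height c d s ^- 2 *:
  vec (exp_comb 0 (c2 ^+ 2 - c1 ^+ 2) (d1 ^+ 2 - d2 ^+ 2) s)
      (exp_comb 0 (2 * (c1 * c2)) (- (2 * (d1 * d2))) s)
      (exp_comb (- (2 * (c1 * d1 + c2 * d2))) 0 0 s).
Proof.
rewrite row2_frame_cd sqnorm_boost /exp_comb.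
have pq : expR (- (s / 2)) * expR (s / 2) = 1 :> R by rewrite -expRD addNr expR0.
rewrite -(expR_half s) -(expR_half (- s)) mulNr.
move: (expR (s / 2)) (expR (- (s / 2))) pq => q p pq.
by congr (_ *: _); rewrite /c /d /sqnorm /pt ?expr2 /=; congr vec; ring: pq.
Qed.
End Rows.

Lemma is_derive_scaled_vec (k u v w : R -> R) (s du dv dw : R) :
  is_derive s 1 (fun x => k x * u x) du -> is_derive s 1 (fun x => k x * v x) dv ->
  is_derive s 1 (fun x => k x * w x) dw ->
  is_derive s 1 (fun x => k x *: vec (u x) (v x) (w x)) (vec du dv dw).
Proof.
move=> hu hv hw.
have -> : (fun x => k x *: vec (u x) (v x) (w x)) =
          fun x => vec (k x * u x) (k x * v x) (k x * w x).
  by apply/funext => x; rewrite vecZ.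
have e0 : (fun x => vec (k x * u x) (k x * v x) (k x * w x) 0 0) = fun x => k x * u x.
  by apply/funext => x; rewrite vecE.
have e1 : (fun x => vec (k x * u x) (k x * v x) (k x * w x) 0 1) = fun x => k x * v x.
  by apply/funext => x; rewrite vecE.
have e2 : (fun x => vec (k x * u x) (k x * v x) (k x * w x) 0 2) = fun x => k x * w x.
  by apply/funext => x; rewrite vecE.
by apply: is_derive_rV3; rewrite ?(e0, e1, e2) vecE.
Qed.

Lemma is_derive_expRN (s : R) : is_derive s 1 (fun x => expR (- x)) (- expR (- s)).
Proof.
have := @is_derive1_comp _ expR -%R s _ _ (is_derive_expR (- s)) (is_deriveNid s 1).
by move/is_derive_eq; apply; rewrite mulrN1.
Qed.

Lemma is_derive_exp_comb (k0 k1 k2 s : R) : is_derive s 1 (exp_comb k0 k1 k2)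
  (exp_comb 0 (- k1) k2 s).
Proof.
have hc (k : R) : is_derive s 1 (fun=> k) 0 by exact: is_derive_cst.
have := is_deriveDR (is_deriveDR (hc k0) (is_deriveMR (hc k1) (is_derive_expRN s)))
  (is_deriveMR (hc k2) (is_derive_expR s)).
by move/is_derive_eq; apply; rewrite /exp_comb; ring.
Qed.

Lemma inv_height_gt0 c d s : 0 < sqnorm c + sqnorm d -> 0 < inv_height c d s.
Proof.
move=> h.
have p := expR_gt0 (- s); have q := expR_gt0 s.
have := sqnorm_ge0 c; rewrite le_eqVlt => /orP[/eqP c0|c0].
  by rewrite /inv_height -c0 mul0r add0r mulr_gt0 //; rewrite -c0 add0r in h.
by rewrite /inv_height ltr_wpDr // ?mulr_ge0 ?sqnorm_ge0 ?ltW // mulr_gt0.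
Qed.

Lemma inv_height_exp_comb c d : inv_height c d = exp_comb 0 (sqnorm c) (sqnorm d).
Proof. by apply/funext => x; rewrite /inv_height /exp_comb add0r. Qed.

Lemma is_derive_inv_heightV c d (k0 k1 k2 s : R) : 0 < inv_height c d s ->
  is_derive s 1 (fun x => (inv_height c d x)^-1 * exp_comb k0 k1 k2 x)
  (inv_height c d s ^- 2 * (exp_comb 0 (- k1) k2 s * inv_height c d s -
     exp_comb k0 k1 k2 s * exp_comb 0 (- sqnorm c) (sqnorm d) s)).
Proof.
move=> h0; have n0 : inv_height c d s != 0 by rewrite gt_eqF.
have -> : (fun x => (inv_height c d x)^-1 * exp_comb k0 k1 k2 x) = (fun x => exp_comb
  k0 k1 k2 x / inv_height c d x).
  by apply/funext => x; rewrite mulrC.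
have Hh : is_derive s 1 (inv_height c d) (exp_comb 0 (- sqnorm c) (sqnorm d) s).
  by rewrite inv_height_exp_comb; exact: is_derive_exp_comb.
have := is_derive_quot n0 (is_derive_exp_comb k0 k1 k2 s) Hh.
by move/is_derive_eq; apply; rewrite mulrC.
Qed.

Lemma is_derive_inv_heightV2 c d (k0 k1 k2 s : R) : 0 < inv_height c d s ->
  is_derive s 1 (fun x => inv_height c d x ^- 2 * exp_comb k0 k1 k2 x)
  (inv_height c d s ^- 3 * (exp_comb 0 (- k1) k2 s * inv_height c d s -
   2 * exp_comb k0 k1 k2 s * exp_comb 0 (- sqnorm c) (sqnorm d) s)).
Proof.
move=> h0; have n0 : inv_height c d s ^+ 2 != 0 by rewrite expf_neq0 // gt_eqF.
have n1 : inv_height c d s != 0 by rewrite gt_eqF.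
have -> : (fun x => inv_height c d x ^- 2 * exp_comb k0 k1 k2 x) = (fun x => exp_comb
  k0 k1 k2 x / inv_height c d x ^+ 2).
  by apply/funext => x; rewrite mulrC.
have Hh : is_derive s 1 (inv_height c d) (exp_comb 0 (- sqnorm c) (sqnorm d) s).
  by rewrite inv_height_exp_comb; exact: is_derive_exp_comb.
have := is_derive_quot (g := fun x => inv_height c d x ^+ 2) (x :=
  s) n0 (is_derive_exp_comb k0 k1 k2 s)
  (is_deriveMR Hh Hh).
by move/is_derive_eq; apply; field.
Qed.

Lemma boost_entries h s : [/\ (h *m boost s) 0 0 = h 0 0 * (expR (- (s / 2)))%:C,
  (h *m boost s) 0 1 = h 0 1 * (expR (s / 2))%:C,
  (h *m boost s) 1 0 = h 1 0 * (expR (- (s / 2)))%:C &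
  (h *m boost s) 1 1 = h 1 1 * (expR (s / 2))%:C].
Proof. by rewrite mul_boost; split; rewrite mxE. Qed.

Lemma det_mul_boost h s : \det h = 1 -> \det (h *m boost s) = 1.
Proof. by move=> dh; rewrite det_mulmx dh det_boost mulr1. Qed.

Lemma tc_geo h s : tc (point_of (h *m boost s)) = (inv_height (h 1 0) (h 1 1) s)^-1.
Proof. by rewrite point_ofE point_abcd_tc; have [_ _ -> ->] := boost_entries h s;
  rewrite sqnorm_boost. Qed.

Lemma inv_height_gt0_det h s : \det h = 1 -> 0 < inv_height (h 1 0) (h 1 1) s.
Proof. by move=> dh; apply: inv_height_gt0; exact: sqnorm2_gt0. Qed.

Lemma geoE h s : let a := h 0 0 in let b := h 0 1 in let c := h 1 0 in let d := h 1 1 in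
  point_of (h *m boost s) = (inv_height c d s)^-1 *:
    vec (exp_comb 0 (Re (a * c^*)) (Re (b * d^*)) s) (exp_comb 0 (Im (a * c^*)) (Im (b
      * d^*)) s)
        (exp_comb 1 0 0 s).
Proof.
move=> a b c d; rewrite point_ofE; have [-> -> -> ->] := boost_entries h s.
rewrite /point_abcd sqnorm_boost -/a -/b -/c -/d /exp_comb; congr (_ *: _).
rewrite -(expR_half s) -(expR_half (- s)) mulNr.
move: (expR (s / 2)) (expR (- (s / 2))) => q p.
by case: a b c d => [a1 a2] [b1 b2] [c1 c2] [d1 d2]; rewrite /pt /=; congr vec; ring.
Qed.

(** As in [is_derive_mobius], the determinant and [e^(-s) e^s] are put back in to get a
    polynomial identity. *)
Lemma is_derive_geo h (s : R) : \det h = 1 ->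
  is_derive s 1 (fun s => point_of (h *m boost s)) (row 0 (frame_of (h *m boost s))).
Proof.
move=> dh; have h0 := inv_height_gt0_det s dh.
have -> : (fun s => point_of (h *m boost s)) = _ := funext (geoE h).
rewrite frame_ofE ?det_mul_boost //; have [_ _ -> ->] := boost_entries h s.
have PQ : expR (- s) * expR s = 1 :> R by rewrite -expRD addNr expR0.
move: dh h0; rewrite det2; case: (h 0 0) (h 0 1) (h 1 0) (h 1 1) => [a1 a2] [b1 b2]
  [c1 c2] [d1 d2].
rewrite row0_boost.
move=> -[] /= dg1 dg2 h0.
have key1 (u1 u2 : R) : u1 = (u1 * (a1 * d1 - a2 * d2 - (b1 * c1 - b2 * c2))
   - u2 * (a1 * d2 + a2 * d1 - (b1 * c2 + b2 * c1))) * (expR (- s) * expR s).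
  by rewrite dg1 dg2 PQ !mulr1 mulr0 subr0.
have key2 (u1 u2 : R) : u2 = (u2 * (a1 * d1 - a2 * d2 - (b1 * c1 - b2 * c2))
   + u1 * (a1 * d2 + a2 * d1 - (b1 * c2 + b2 * c1))) * (expR (- s) * expR s).
  by rewrite dg1 dg2 PQ !mulr1 mulr0 addr0.
pose w1 := - (2 * (c1 * d1 - c2 * d2)); pose w2 := 2 * (c1 * d2 + c2 * d1).
rewrite vecZ; apply: is_derive_scaled_vec.
- apply: is_derive_eq; first exact: is_derive_inv_heightV.
  congr (_ * _); rewrite /exp_comb -/w1 (key1 w1 w2) /inv_height /sqnorm /= /w1 /w2;
    ring.
- apply: is_derive_eq; first exact: is_derive_inv_heightV.
  congr (_ * _); rewrite /exp_comb -/w2 (key2 w1 w2) /inv_height /sqnorm /= /w1 /w2;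
    ring.
- apply: is_derive_eq; first exact: is_derive_inv_heightV.
  congr (_ * _); rewrite /exp_comb /inv_height /sqnorm /=; ring.
Qed.

(** Parallelism of the three explicit rows is, after removing the powers of
    [inv_height], a polynomial identity modulo [e^(-s) e^s = 1]. *)
Lemma spin_parallel_geo h : \det h = 1 ->
  spin_parallel_along (fun s => point_of (h *m boost s)) (fun s => h *m boost s).
Proof.
move=> dh; split.
- have ce (k : R) : continuous (fun s : R => (expR (k * s))%:C).
    move=> s; apply: (@continuous_realc R R (fun s => expR (k * s)) s).
    apply: (@continuous_comp _ _ _ (fun s => k * s) expR); last exact: continuous_expR.
    by apply: cvgM; [exact: cvg_cst|exact: cvg_id].
  have e1 : (fun s : R => (expR (- (s / 2)))%:C) = fun s => (expR (- 2^-1 * s))%:C.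
    by apply/funext => s; congr (expR _)%:C; ring.
  have e2 : (fun s : R => (expR (s / 2))%:C) = fun s => (expR (2^-1 * s))%:C.
    by apply/funext => s; congr (expR _)%:C; ring.
  apply: continuous_cst_mul22.
  + by rewrite e1; exact: ce.
  + by move=> s; exact: cvg_cst.
  + by move=> s; exact: cvg_cst.
  + by rewrite e2; exact: ce.
- by move=> s; split=> //; rewrite inE; exact: det_mul_boost.
move=> i; apply/(parallel_alongP _ (fun s => is_derive_geo s dh)) => s.
have h0 := inv_height_gt0_det s dh.
have PQ : expR (- s) * expR s = 1 :> R by rewrite -expRD addNr expR0.
have eF x : frame_of (h *m boost x) = frame_cd (h 1 0 * (expR (- (x / 2)))%:C) (h 1 1
  * (expR (x / 2))%:C).
  by rewrite frame_ofE ?det_mul_boost //; have [_ _ -> ->] := boost_entries h x.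
have -> : (fun x => row i (frame_of (h *m boost x))) =
   fun x => row i (frame_cd (h 1 0 * (expR (- (x / 2)))%:C) (h 1 1 * (expR (x /
     2))%:C)).
  by apply/funext => x; rewrite eF.
rewrite eF /transport_rhs tc_geo invrK.
move: h0 {eF}; case: (h 1 0) (h 1 1) => [c1 c2] [d1 d2] h0.
have n0 : inv_height (c1 +i* c2) (d1 +i* d2) s != 0 by rewrite gt_eqF.
have f0 := funext (row0_boost c1 c2 d1 d2).
have f1 := funext (row1_boost c1 c2 d1 d2).
have f2 := funext (row2_boost c1 c2 d1 d2).
have rhs x0 x1 x2 y0 y1 y2 (D := inv_height (c1 +i* c2) (d1 +i* d2) s) :
    D *: (tc (D ^- 2 *: vec x0 x1 x2) *: (D ^- 2 *: vec y0 y1 y2)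
      + tc (D ^- 2 *: vec y0 y1 y2) *: (D ^- 2 *: vec x0 x1 x2)
      - dot (D ^- 2 *: vec x0 x1 x2) (D ^- 2 *: vec y0 y1 y2) *: vec 0 0 1) =
    vec (D ^- 3 * (x2 * y0 + y2 * x0)) (D ^- 3 * (x2 * y1 + y2 * x1))
        (D ^- 3 * (x2 * y2 - x0 * y0 - x1 * y1)).
  rewrite /tc dotE !vecZ !vecE !vecD vecB !vecZ; congr vec; rewrite /D; field => //.
move: i; apply: ord3P; rewrite ?row0_boost ?row1_boost ?row2_boost rhs {rhs} ?(f0, f1,
  f2) {f0 f1 f2};
  apply: is_derive_eq; try (apply: is_derive_scaled_vec; exact: is_derive_inv_heightV2);
  congr vec; congr (_ * _); rewrite /exp_comb /inv_height /sqnorm /=; ring: PQ.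
Qed.
End Parallel.

(** * Geodesics are determined by their initial velocity *)

Section Geodesics.
Variable R : realType.
Implicit Types (p : 'rV[R]_3) (a b c d z : R[i]) (g h : 'M[R[i]]_2).

Lemma unit_speed_geodesicP (c X : R -> 'rV[R]_3) : (forall s : R,
  is_derive s 1 c (X s)) ->
  unit_speed_geodesic c <-> [/\ forall s, 0 < tc (c s), forall s,
    dot (X s) (X s) = tc (c s) ^+ 2
    & parallel_along c X].
Proof.
move=> HX; have eX : derive1 c = X.
  by apply/funext => s; rewrite derive1E (@derive_val _ _ _ _ _ _ _ (HX s)).
rewrite /unit_speed_geodesic eX; split=> [[H1 H2]|[H1 H2 H3]].
  by split=> // s; have [] := H1 s.
by split=> // s; split=> //; exact: (@ex_derive _ _ _ _ _ _ _ (HX s)).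
Qed.

Lemma unit_speed_geo h : \det h = 1 -> unit_speed_geodesic (fun s => point_of (h *m
  boost s)).
Proof.
move=> dh; apply/(unit_speed_geodesicP (fun s => is_derive_geo s dh)); split.
- by move=> s; rewrite point_det // det_mul_boost.
- move=> s; have dhs := det_mul_boost s dh.
  by rewrite -mul_trmx_dot frame_orthonormal // mxE eqxx mulr1n.
- by have [_ _] := spin_parallel_geo dh; apply.
Qed.

Lemma is_derive_const (f : R -> R) : (forall x : R, is_derive x 1 f 0) ->
  forall s, f s = f 0.
Proof. by move=> H s; exact: is_derive_0_is_cst. Qed.

(** With [u = 1/t] the geodesic equation says [u'' = u], so that [e^(-s) (u + u')] and
    [e^s (u - u')] are constant; here [u' = - X_t / t^2]. *)
Lemma geodesic_first_integrals (c X : R -> 'rV[R]_3) :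
  (forall s : R, is_derive s 1 c (X s)) ->
  unit_speed_geodesic c ->
  [/\ forall s, X s 0 0 / tc (c s) ^+ 2 = X 0 0 0 / tc (c 0) ^+ 2,
      forall s, X s 0 1 / tc (c s) ^+ 2 = X 0 0 1 / tc (c 0) ^+ 2 &
      forall s, expR (- s) * ((tc (c s))^-1 - X s 0 2 / tc (c s) ^+ 2) =
                (tc (c 0))^-1 - X 0 0 2 / tc (c 0) ^+ 2 /\
                expR s * ((tc (c s))^-1 + X s 0 2 / tc (c s) ^+ 2) =
                (tc (c 0))^-1 + X 0 0 2 / tc (c 0) ^+ 2].
Proof.
move=> HX /(unit_speed_geodesicP HX)[t0 XX /(parallel_alongP _ HX) HP].
have Ht (s : R) : is_derive s 1 (fun s => tc (c s)) (X s 0 2) by exact: is_derive_coord.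
have n0 s : tc (c s) != 0 by rewrite gt_eqF.
have n20 s : tc (c s) ^+ 2 != 0 by rewrite expf_neq0.
have Hq j (s : R) := is_derive_quot (f := fun s => X s 0 j) (g :=
  fun s => tc (c s) ^+ 2) (n20 s)
  (is_derive_coord j (HP s)) (is_deriveMR (Ht s) (Ht s)).
have HP01 j (s : R) : vec 0 0 1 0 j = 0 :> R ->
  is_derive s 1 (fun s => X s 0 j / tc (c s) ^+ 2) 0.
  move=> ej; have := Hq j s; move/is_derive_eq; apply.
  have := n0 s; rewrite transport_rhsE XX ej /tc => n; field => //.
have HV (s : R) : is_derive s 1 (fun s => (tc (c s))^-1) (- (X s 0 2 / tc (c s) ^+ 2)).
  have := is_deriveV (n0 s) (Ht s); move/is_derive_eq; apply; rewrite /GRing.scale /=.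
  by rewrite mulNr mulrC.
have HW (s : R) : is_derive s 1 (fun s => X s 0 2 / tc (c s) ^+ 2) (- (tc (c s))^-1).
  have := Hq 2 s; move/is_derive_eq; apply.
  have := n0 s; rewrite transport_rhsE XX vec2 /tc => n; field => //.
split.
- by apply: is_derive_const => x; apply: HP01; exact: vec0.
- by apply: is_derive_const => x; apply: HP01; exact: vec1.
move=> s; split.
- rewrite (is_derive_const (f := fun s => expR (- s) * ((tc (c s))^-1 - X s 0 2 / tc
    (c s) ^+ 2)) _ s).
    by rewrite oppr0 expR0 mul1r.
  move=> x; have := is_deriveMR (is_derive_expRN x) (is_deriveBR (HV x) (HW x)).
  by move/is_derive_eq; apply; ring.
- rewrite (is_derive_const (f := fun s => expR s * ((tc (c s))^-1 +
    X s 0 2 / tc (c s) ^+ 2)) _ s).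
    by rewrite expR0 mul1r.
  move=> x; have := is_deriveMR (is_derive_expR x) (is_deriveDR (HV x) (HW x)).
  by move/is_derive_eq; apply; ring.
Qed.

(** The first integrals give [1/t] from its initial data, then [x'] and [y']. *)
Lemma geodesic_unique (c c' X X' : R -> 'rV[R]_3) :
  (forall s : R, is_derive s 1 c (X s)) -> (forall s : R, is_derive s 1 c' (X' s)) ->
  unit_speed_geodesic c -> unit_speed_geodesic c' -> c 0 = c' 0 -> X 0 = X' 0 ->
    c =1 c'.
Proof.
move=> HX HX' gc gc' e0 eX.
have [h0 h1 h2] := geodesic_first_integrals HX gc.
have [k0 k1 k2] := geodesic_first_integrals HX' gc'.
have /(unit_speed_geodesicP HX)[t0 _ _] := gc.
have /(unit_speed_geodesicP HX')[t0' _ _] := gc'.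
have et s : tc (c s) = tc (c' s).
  apply: invr_inj.
  have [a1 a2] := h2 s; have [b1 b2] := k2 s.
  have p := expR_gt0 (- s); have q := expR_gt0 s.
  have e1 : (tc (c s))^-1 - X s 0 2 / tc (c s) ^+ 2 = (tc (c' s))^-1 - X' s 0 2 / tc
    (c' s) ^+ 2.
    by apply: (mulfI (lt0r_neq0 p)); rewrite a1 b1 e0 eX.
  have e2 : (tc (c s))^-1 + X s 0 2 / tc (c s) ^+ 2 = (tc (c' s))^-1 +
    X' s 0 2 / tc (c' s) ^+ 2.
    by apply: (mulfI (lt0r_neq0 q)); rewrite a2 b2 e0 eX.
  lra.
have hj j : (forall s, X s 0 j / tc (c s) ^+ 2 = X 0 0 j / tc (c 0) ^+ 2) ->
    (forall s, X' s 0 j / tc (c' s) ^+ 2 = X' 0 0 j / tc (c' 0) ^+ 2) ->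
    forall s, c s 0 j = c' s 0 j.
  move=> H H' s; apply/eqP; rewrite -subr_eq0; apply/eqP.
  rewrite (is_derive_const (f := fun s => c s 0 j - c' s 0 j) _ s) ?e0 ?subrr // => x.
  have := is_deriveBR (is_derive_coord j (HX x)) (is_derive_coord j (HX' x)).
  move/is_derive_eq; apply; apply/eqP; rewrite subr_eq0; apply/eqP.
  have n2 : tc (c x) ^+ 2 != 0 by rewrite expf_neq0 // gt_eqF.
  by apply: (mulIf (invr_neq0 n2)); rewrite {2}et H H' e0 eX.
by move=> s; apply: rV3P; [exact: hj|exact: hj|exact: et].
Qed.

(** The matrix with second row [(c, d)] over the point [(z, t)]. *)
Definition spin_frame_at c d z (t : R) : 'M[R[i]]_2 :=
  mx22 (c * z + d^* * t%:C) (d * z - c^* * t%:C) c d.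

Lemma spin_frame_atP c d z (t : R) : t * (sqnorm c + sqnorm d) = 1 ->
  \det (spin_frame_at c d z t) = 1 /\ point_of (spin_frame_at c d z t) = pt z t.
Proof.
move=> h; have hC : t%:C * (c * c^* + d * d^*) = 1
  by rewrite -!sqnormE -rmorphD -rmorphM h.
have n0 : sqnorm c + sqnorm d != 0.
  by apply/eqP => e; move: h; rewrite e mulr0 => /esym/eqP; rewrite oner_eq0.
have et : (sqnorm c + sqnorm d)^-1 = t by apply: (mulIf n0); rewrite mulVf.
split; first by rewrite /spin_frame_at det_mx22 -[RHS]hC; ring.
rewrite point_ofE /spin_frame_at; have [-> -> -> ->] :=
  mx22E (c * z + d^* * t%:C) (d * z - c^* * t%:C) c d.
rewrite /point_abcd et /pt vecZ mulr1.
have -> : (c * z + d^* * t%:C) * c^* + (d * z - c^* * t%:C) * d^* = z / t%:C.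
  have t0 : t%:C != 0 :> R[i] by rewrite -et fmorph_eq0 invr_eq0.
  apply: (mulIf t0); rewrite divfK // -[RHS]mulr1 -hC; ring.
have t0 : t != 0 by rewrite -et invr_eq0.
by rewrite div_real_complex /=; congr vec; field.
Qed.

(** Solving for the first vector: its coordinates prescribe [|c|^2], [|d|^2] and [cd],
    and these are compatible because [X] is a unit vector. *)
Lemma frame_transitive (p X : 'rV[R]_3) : 0 < tc p -> dot X X = tc p ^+ 2 ->
  exists h, [/\ \det h = 1, point_of h = p & row 0 (frame_of h) = X].
Proof.
move=> t0 XX; set t := tc p in t0 XX *.
pose n := (t + X 0 2) / (2 * t ^+ 2); pose m := (t - X 0 2) / (2 * t ^+ 2).
pose w : R[i] := (- X 0 0 / (2 * t ^+ 2)) +i* (X 0 1 / (2 * t ^+ 2)).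
have tn : t != 0 by rewrite gt_eqF.
have t2 : 0 < 2 * t ^+ 2 by rewrite mulr_gt0 // exprn_gt0.
have nm : n + m = t^-1 by rewrite /n /m; field.
have wnm : sqnorm w = n * m.
  rewrite /sqnorm /w /n /m /=; move: XX; rewrite dotE -!expr2 => XX.
  transitivity ((X 0 0 ^+ 2 + X 0 1 ^+ 2) / (2 * t ^+ 2) ^+ 2); first by field.
  have -> : X 0 0 ^+ 2 + X 0 1 ^+ 2 = t ^+ 2 - X 0 2 ^+ 2 by rewrite -XX; ring.
  by field.
have XX2 : X 0 2 ^+ 2 <= t ^+ 2 by rewrite -XX dotE -!expr2; have := sqr_ge0 (X 0 0);
  have := sqr_ge0 (X 0 1); lra.
have /andP[Xl Xu] : - t <= X 0 2 <= t.
  by apply/andP; split; nra.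
have n0 : 0 <= n by rewrite divr_ge0 ?(ltW t2) //; lra.
have m0 : 0 <= m by rewrite divr_ge0 ?(ltW t2) //; lra.
have [c [d [nc nd cd]]] : exists c d : R[i], [/\ sqnorm c = n,
  sqnorm d = m & c * d = w].
  have [n1|n1] := eqVneq n 0.
    exists 0, (Num.sqrt m)%:C; split.
    - by rewrite n1 /sqnorm /= expr0n addr0.
    - by rewrite /sqnorm /= expr0n addr0 sqr_sqrtr.
    - by rewrite mul0r; apply/esym/eqP; rewrite -sqnorm_eq0 wnm n1 mul0r.
  have s0 : (Num.sqrt n)%:C != 0 :> R[i] by rewrite fmorph_eq0 sqrtr_eq0 -ltNge lt_def
    n1.
  have es : sqnorm (Num.sqrt n)%:C = n by rewrite /sqnorm /= expr0n addr0 sqr_sqrtr.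
  exists (Num.sqrt n)%:C, (w / (Num.sqrt n)%:C); split=> //;
    last by rewrite mulrC divfK.
  by apply: (mulfI n1); rewrite -wnm -{1}es -sqnormM mulrC divfK.
have hD : t * (sqnorm c + sqnorm d) = 1 by rewrite nc nd nm divff.
have [dh ph] := spin_frame_atP (zc p) hD.
exists (spin_frame_at c d (zc p) t); split=> //.
  by rewrite ph; apply: rV3P; rewrite /pt vecE.
rewrite frame_ofE //; have [_ _ -> ->] :=
  mx22E (c * zc p + d^* * t%:C) (d * zc p - c^* * t%:C) c d.
rewrite row0_frame_cd nc nd nm exprVn invrK cd /pt vecZ.
by apply: rV3P; rewrite vecE /w /n /m /=; field.
Qed.

End Geodesics.

(** * End points of geodesics *)

Section Boundary.
Variable R : realType.
Implicit Types (p : 'rV[R]_3) (a b c d z : R[i]) (g h : 'M[R[i]]_2).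

(** The point of the boundary with homogeneous coordinates [(x : y)]. *)
Definition boundary_pt (x y : R[i]) : option R[i] :=
  if y == 0 then None else Some (x / y).

Lemma boundary_pt_scale (k x y : R[i]) : k != 0 ->
  boundary_pt (k * x) (k * y) = boundary_pt x y.
Proof. by move=> k0; rewrite /boundary_pt mulf_eq0 (negbTE k0) /= -mulf_div divff //
  mul1r. Qed.

Lemma boundary_pt_inj x y x' y' : (x, y) != (0, 0) -> (x', y') != (0, 0) ->
  boundary_pt x y = boundary_pt x' y' -> exists2 k,
    k != 0 & (x = k * x') /\ (y = k * y').
Proof.
rewrite /boundary_pt !xpair_eqE !negb_and; have [->|y0] := eqVneq y 0;
  have [->|y0'] := eqVneq y' 0 => //=.
  rewrite !orbF => x0 x0' _; exists (x / x'); first by rewrite mulf_neq0 ?invr_neq0.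
  by rewrite divfK // mulr0.
move=> _ _ [e]; exists (y / y'); first by rewrite mulf_neq0 ?invr_neq0.
split; last by rewrite divfK.
by rewrite -[LHS](divfK y0) e; ring.
Qed.

Lemma spin_rot1_pi g : g *m spin_rot1 pi = mx22 (g 0 1) (- g 0 0) (g 1 1) (- g 1 0).
Proof.
rewrite /spin_rot1 cos_pihalf sin_pihalf mul_mx22 rmorphN rmorph1 rmorph0.
by rewrite !mulr0 !mulr1 !mulrN1 !add0r !addr0.
Qed.

Lemma spin_rot1_Npi g : g *m spin_rot1 (- pi) = mx22 (- g 0 1) (g 0 0) (- g 1 1) (g 1
  0).
Proof.
rewrite /spin_rot1 mulNr cosN sinN cos_pihalf sin_pihalf mul_mx22 opprK rmorphN
  rmorph1 rmorph0.
by rewrite !mulr0 !mulr1 !mulrN1 !add0r !addr0.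
Qed.

(** Turning by [pi] about the second vector reverses the first one. *)
Lemma geo_reverse h s :
  point_of (h *m boost (- s)) = point_of ((h *m spin_rot1 pi) *m boost s).
Proof.
rewrite -(point_of_rot1 _ pi); congr point_of.
rewrite !spin_rot1_pi /boost !mul_mx22 !mxE /= mulNr opprK.
by rewrite !mulr0 !addr0 !add0r -!mulNr.
Qed.

Lemma le_coord_norm (v : 'rV[R]_3) j : `|v 0 j| <= `|v|.
Proof.
rewrite [leRHS]/Num.Def.normr /= mx_normrE.
exact: (le_bigmax _ (fun ij : 'I_1 * 'I_3 => `|v ij.1 ij.2|) (0, j)).
Qed.

Lemma cvg_rV3 (T : Type) (F : set_system T) (FF : Filter F) (f : T ->
  'rV[R]_3) (v : 'rV[R]_3) :
  (forall j, f x 0 j @[x --> F] --> v 0 j) -> f x @[x --> F] --> v.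
Proof.
move=> H; apply/cvg_mx_entourageP => A entA.
apply: filter_forall => i; apply: filter_forall => j; rewrite (ord1 i).
have /cvg_entourageP/(_ A entA) h := H j.
change (\forall s \near F, (v 0 j, f s 0 j) \in A).
have {}h : \forall s \near F, A (v 0 j, f s 0 j) := h.
by near=> s; rewrite inE; near: s.
Unshelve. all: by end_near. Qed.

Lemma cvg_inv_height_exp_comb c d (k0 k1 k2 : R) : d != 0 ->
  (inv_height c d s)^-1 * exp_comb k0 k1 k2 s @[s --> +oo] --> k2 / sqnorm d.
Proof.
move=> d0; have E0 : sqnorm d != 0 by rewrite sqnorm_eq0.
pose P (s : R) := expR (- s).
have -> : (fun s => (inv_height c d s)^-1 * exp_comb k0 k1 k2 s) =
   fun s => (k0 * P s + k1 * (P s * P s) + k2) / (sqnorm c * (P s * P s) + sqnorm d).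
  apply/funext => s; have h0 : 0 < inv_height c d s.
    by apply: inv_height_gt0; rewrite ltr_wpDl ?sqnorm_ge0 ?sqnorm_gt0.
  have p0 : 0 < P s by exact: expR_gt0.
  have PQ : P s * expR s = 1 by rewrite -expRD addNr expR0.
  rewrite (_ : exp_comb _ _ _ _ = expR s * (k0 * P s + k1 * (P s * P s) + k2));
    last first.
    by rewrite /exp_comb -/(P s); ring: PQ.
  rewrite (_ : inv_height _ _ _ = expR s * (sqnorm c * (P s * P s) + sqnorm d));
    last first.
    by rewrite /inv_height -/(P s); ring: PQ.
  by rewrite invfM mulrACA mulVf ?gt_eqF ?expR_gt0 // mul1r mulrC.
have P0 : P s @[s --> +oo] --> 0 by exact: cvgr_expR.
have PP0 : P s * P s @[s --> +oo] --> 0 by rewrite -[X in _ --> X](mulr0 0);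
  exact: cvgM.
have cst (k : R) : k @[s --> +oo] --> k by exact: cvg_cst.
apply: cvgM.
  rewrite -[X in _ --> X]add0r -[X in _ --> X + _]addr0.
  apply: cvgD; last exact: cst.
  rewrite -[X in _ --> X + _](mulr0 k0) -[X in _ --> _ + X](mulr0 k1).
  by apply: cvgD; apply: cvgM; (exact: cst || exact: P0 || exact: PP0).
apply: cvgV => //; rewrite -[X in _ --> X]add0r -[X in _ --> X + _](mulr0 (sqnorm c)).
by apply: cvgD; [apply: cvgM; [exact: cst|exact: PP0]|exact: cst].
Qed.

Lemma div_complexE (x y : R[i]) : x / y = (x * y^*) / (sqnorm y)%:C.
Proof.
have [->|y0] := eqVneq y 0; first by rewrite invr0 conjc0 !mulr0 mul0r.
have yJ : y^* != 0 by rewrite conjc_eq0.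
by rewrite sqnormE; field; rewrite y0 yJ.
Qed.

Lemma geo_pinfty h : \det h = 1 ->
  tends_to_boundary (fun s => point_of (h *m boost s)) (pinfty_nbhs R) (boundary_pt (h
    0 1) (h 1 1)).
Proof.
move=> dh; rewrite /tends_to_boundary /boundary_pt.
have [d0|d0] := eqVneq (h 1 1) 0.
  have C0 : 0 < sqnorm (h 1 0) by have := sqnorm2_gt0 dh;
    rewrite d0 {2}/sqnorm /= expr0n !addr0.
  apply/cvgryPge => A; near=> s.
  apply: le_trans (le_coord_norm _ 2); apply: le_trans (ler_norm _).
  rewrite -/(tc _) tc_geo d0 /inv_height {2}/sqnorm /= expr0n !addr0 mul0r addr0 invfM
    expRN invrK.
  rewrite ler_pdivlMl // (le_trans _ (expR_ge1Dx _)) // -lerBlDl.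
  by near: s; apply: nbhs_pinfty_ge; exact: num_real.
apply: cvg_rV3; apply: ord3P.
- under eq_cvg do rewrite geoE vecZ vecE.
  rewrite /pt vec0 div_complexE div_real_complex; exact: cvg_inv_height_exp_comb.
- under eq_cvg do rewrite geoE vecZ vecE.
  rewrite /pt vec1 div_complexE div_real_complex; exact: cvg_inv_height_exp_comb.
- under eq_cvg do rewrite geoE vecZ vecE.
  by have := @cvg_inv_height_exp_comb (h 1 0) (h 1 1) 1 0 0 d0; rewrite mul0r /pt vec2.
Unshelve. all: by end_near. Qed.

Lemma geo_ninfty h : \det h = 1 ->
  tends_to_boundary (fun s => point_of (h *m boost s)) (ninfty_nbhs R) (boundary_pt (h
    0 0) (h 1 0)).
Proof.
move=> dh; have dh' : \det (h *m spin_rot1 pi) = 1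
  by rewrite det_mulmx dh det_spin_rot1 mulr1.
have e01 : (h *m spin_rot1 pi) 0 1 = -1 * h 0 0 by rewrite spin_rot1_pi mxE mulN1r.
have e11 : (h *m spin_rot1 pi) 1 1 = -1 * h 1 0 by rewrite spin_rot1_pi mxE mulN1r.
have := geo_pinfty dh'; rewrite e01 e11 boundary_pt_scale ?oppr_eq0 ?oner_eq0 //.
rewrite /tends_to_boundary; case: (boundary_pt _ _) => [z|] H; apply/cvgNy_compNP;
  rewrite /comp;
by under eq_cvg do rewrite geo_reverse.
Qed.

Lemma geodesic_geo h : \det h = 1 ->
  geodesic_from_to (boundary_pt (h 0 0) (h 1 0)) (boundary_pt (h 0 1) (h 1 1)) (fun s
    => point_of (h *m boost s)).
Proof. by move=> dh; split; [exact: unit_speed_geo|exact: geo_ninfty|exact: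
  geo_pinfty]. Qed.

Lemma boundary_unique (c : R -> 'rV[R]_3) (l : set_system R) (Fl : ProperFilter l) (b
  b' : option R[i]) :
  tends_to_boundary c l b -> tends_to_boundary c l b' -> b = b'.
Proof.
have noinf z : `|c s| @[s --> l] --> +oo -> c s @[s --> l] --> pt z 0 -> False.
  move=> /cvgryPgt/(_ (`|pt z 0| + 1)) H1 /cvg_norm/cvgrPdist_lt/(_ 1 ltr01) H2.
  have [s /= [h1 h2]] := filter_ex (filterI H1 H2).
  have := ler_norm (`|c s| - `|pt z 0|); rewrite distrC => h3; lra.
case: b b' => [z|] [z'|] //= H H'; last 2 first.
- by case: (noinf z H' H).
- by case: (noinf z' H H').
- by have [-> _] := pt_inj (cvg_unique (@norm_hausdorff R 'rV[R]_3) H H').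
Qed.

(** A geodesic starts like some explicit one, hence coincides with it, and limits
    are unique. *)
Lemma geodesic_classification (c : R -> 'rV[R]_3) (b b' : option R[i]) :
  geodesic_from_to b b' c ->
  exists h, [/\ \det h = 1, forall s, c s = point_of (h *m boost s),
    b = boundary_pt (h 0 0) (h 1 0) & b' = boundary_pt (h 0 1) (h 1 1)].
Proof.
move=> [gc lc lc'].
have HX (s : R) : is_derive s 1 c (derive1 c s).
  by have [/(_ s)[_ dc _] _] := gc; rewrite derive1E; exact/derivableP.
have /(unit_speed_geodesicP HX)[t0 XX _] := gc.
have [h [dh ph fh]] := frame_transitive (t0 0) (XX 0).
have b0 : h *m boost 0 = h.
  rewrite /boost mul0r oppr0 expR0 rmorph1 mul_mx22 !mulr1 !mulr0 !addr0 !add0r.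
  by rewrite -mx22_eta.
have e : c =1 fun s => point_of (h *m boost s).
  apply: (geodesic_unique HX (fun s => is_derive_geo s dh) gc (unit_speed_geo dh)).
    by rewrite b0 ph.
  by rewrite b0 fh.
have {}e : c = fun s => point_of (h *m boost s) by exact/funext.
exists h; split=> //; first by rewrite e.
- by apply: boundary_unique lc _; rewrite e; exact: geo_ninfty.
- by apply: boundary_unique lc' _; rewrite e; exact: geo_pinfty.
Qed.

End Boundary.

(** * The lambda-length of two spinors *)

Section Lambda.
Variable R : realType.
Implicit Types (p : 'rV[R]_3) (a b c d z : R[i]) (g h : 'M[R[i]]_2) (k : 'cV[R[i]]_2)
  (H : spin_decorated_horosphere R).

Lemma unit_complex_cis z : sqnorm z = 1 -> exists t, z = cis t.
Proof.
case: z => x y; rewrite /sqnorm /= => xy.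
have y2 : y ^+ 2 = 1 - x ^+ 2 by rewrite -xy; ring.
have x1 : -1 <= x <= 1 by apply/andP; split; have := sqr_ge0 y; nra.
have [y0|y0] := leP 0 y.
  by exists (acos x); rewrite /cis acosK // sin_acos // -y2 sqrtr_sqr ger0_norm.
exists (- acos x); rewrite /cis cosN sinN acosK // sin_acos // -y2 sqrtr_sqr ltr0_norm
  // opprK //.
Qed.

Lemma polar z : z != 0 -> exists t, z = (Num.sqrt (sqnorm z))%:C * cis t.
Proof.
move=> z0; have s0 : 0 < Num.sqrt (sqnorm z) by rewrite sqrtr_gt0 sqnorm_gt0.
have n0 : (Num.sqrt (sqnorm z))%:C != 0 :> R[i] by rewrite fmorph_eq0 gt_eqF.
have [t et] : exists t, z / (Num.sqrt (sqnorm z))%:C = cis t.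
  apply: unit_complex_cis; rewrite div_real_complex /sqnorm /= !exprMn -mulrDl !exprVn.
  by rewrite sqr_sqrtr ?sqnorm_ge0 // divff // gt_eqF // sqnorm_gt0.
by exists t; rewrite -et mulrC divfK.
Qed.

Lemma cexp_half (rho t : R) : cexp ((rho +i* t) / 2) = (expR (rho / 2))%:C * cis (t /
  2).
Proof.
have -> : (2 : R[i]) = (2 : R)%:C by rewrite rmorph_nat.
by rewrite div_real_complex.
Qed.

(** Conversely to [spin_frame_at]: the first row in terms of the second row and the
    point. *)
Lemma spin_frame_coords g : \det g = 1 -> let p := point_of g in
  g 0 0 = g 1 0 * zc p + (g 1 1)^* * (tc p)%:C /\
  g 0 1 = g 1 1 * zc p - (g 1 0)^* * (tc p)%:C.
Proof.
move=> dg p; have D0 := sqnorm2_gt0 dg.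
have [ea eb] := first_row_of_point (etrans (esym (det2 g)) dg).
rewrite /p point_ofE point_abcd_tc; set D := sqnorm _ + sqnorm _ in D0 ea eb *.
have n0 : D%:C != 0 :> R[i] by rewrite fmorph_eq0 gt_eqF.
have -> : zc (point_abcd (g 0 0) (g 0 1) (g 1 0) (g 1 1)) = (g 0 0 * (g 1 0)^* +
  g 0 1 * (g 1 1)^*) / D%:C.
  by rewrite /point_abcd /pt vecZ zc_vec div_real_complex -/D ![D^-1 * _]mulrC.
rewrite fmorphV; split; apply: (mulIf n0);
  first by rewrite mulrDl -!mulrA !mulVf // !mulr1.
by rewrite mulrBl -!mulrA !mulVf // !mulr1.
Qed.

(** This equation is the horosphere of the spinor [(a, c)], in a form that does not
    distinguish the centre at infinity from the finite ones. *)
Lemma horosphere_of_point g : \det g = 1 -> let p := point_of g in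
  sqnorm (g 0 0 - g 1 0 * zc p) + sqnorm (g 1 0) * tc p ^+ 2 = tc p.
Proof.
move=> dg p; have [e0 _] := spin_frame_coords dg.
rewrite -/p in e0; rewrite {}e0 [g 1 0 * _ + _]addrC addrK.
rewrite sqnormM sqnorm_conj sqnorm_realc -mulrDl addrC addrC [sqnorm (g 1 1) + _]addrC.
rewrite /p point_ofE point_abcd_tc; set D := sqnorm _ + sqnorm _.
have n0 : D != 0 by rewrite /D gt_eqF // sqnorm2_gt0.
by field.
Qed.

Lemma spinor_nz k : (k != 0) = ((k 0 0, k 1 0) != (0, 0)).
Proof.
congr (~~ _); apply/eqP/eqP => [->|[e0 e1]]; first by rewrite !mxE.
by apply/colP; apply: ord2P; rewrite mxE.
Qed.

Definition spinor_height k : R :=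
  if k 1 0 == 0 then sqnorm (k 0 0) else (sqnorm (k 1 0))^-1.

Lemma horosphere_of_spinor k p : k != 0 ->
  horosphere (boundary_pt (k 0 0) (k 1 0)) (spinor_height k) p <->
  0 < tc p /\ sqnorm (k 0 0 - k 1 0 * zc p) + sqnorm (k 1 0) * tc p ^+ 2 = tc p.
Proof.
rewrite /boundary_pt /spinor_height /horosphere spinor_nz;
  have [->|e0] := eqVneq (k 1 0) 0.
  rewrite xpair_eqE eqxx andbT => k0 /=.
  rewrite mul0r subr0 (sqnorm_realc 0) expr0n mul0r addr0.
  by split=> [->|[_ ->//]]; split=> //; exact: sqnorm_gt0.
move=> _ /=; have n0 := sqnorm_gt0 e0.
have -> : sqnorm (k 0 0 - k 1 0 * zc p) = sqnorm (k 1 0) * sqnorm (zc p - k 0 0 / k 1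
  0).
  by rewrite -sqnormM -sqnormN; congr sqnorm; field.
have n1 : sqnorm (k 1 0) != 0 by rewrite gt_eqF.
rewrite -mulrDr; split=> -[t0 e]; split=> //.
  by rewrite e mulVKf.
by apply: (mulfI n1); rewrite e mulVKf.
Qed.

Lemma centre_of_spinor k H : decoration_of_spinor k H ->
  centre H = boundary_pt (k 0 0) (k 1 0).
Proof. by rewrite /decoration_of_spinor /boundary_pt; case: eqP => _ []. Qed.

Lemma height_of_spinor k H : decoration_of_spinor k H -> height H = spinor_height k.
Proof. by rewrite /decoration_of_spinor /spinor_height; case: eqP => _ []. Qed.

Lemma horo_of_spinor k H p : k != 0 -> decoration_of_spinor k H ->
  horo H p <-> 0 < tc p /\ sqnorm (k 0 0 - k 1 0 * zc p) +
    sqnorm (k 1 0) * tc p ^+ 2 = tc p.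
Proof.
move=> k0 dk; rewrite /horo (centre_of_spinor dk) (height_of_spinor dk).
exact: horosphere_of_spinor.
Qed.

(** The normalisation of the inward lift determines it on the whole horosphere, since
    its frames are exactly the matrices with first column [k]; the outward one follows from
    uniqueness of the lifted rotation. *)
Lemma spinor_win k H g : spinor_horosphere k H -> \det g = 1 ->
  g 0 0 = k 0 0 -> g 1 0 = k 1 0 ->
  [/\ horo H (point_of g), win H (point_of g) = g
    & wout H (point_of g) = g *m spin_rot1 (- pi)].
Proof.
move=> [k0 dk wk] dg e0 e1.
have hg : horo H (point_of g).
  by apply/(horo_of_spinor _ k0 dk); split;
    [exact: point_det | rewrite -e0 -e1 horosphere_of_point].
have ew : win H (point_of g) = g.
  by apply: wk; [rewrite inE | apply/colP; apply: ord2P; rewrite mxE].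
split=> //; apply: spin_rotation_unique (win_wout hg) _.
by rewrite ew; exact: spin_rotation1.
Qed.

(** Proportional spinors have the same centre, and their heights differ by the
    squared modulus of the factor. *)
Lemma spinor_normalize k H g (kap : R[i]) : spinor_horosphere k H -> \det g = 1 ->
  g 0 0 = kap * k 0 0 -> g 1 0 = kap * k 1 0 -> horo H (point_of g) ->
    exists t, kap = cis t.
Proof.
move=> [k0 dk _] dg e0 e1 /(horo_of_spinor _ k0 dk)[t0 e].
apply: unit_complex_cis; have := horosphere_of_point dg;
  rewrite /= e0 e1 -mulrA -mulrBr !sqnormM -mulrA -mulrDr e.
by rewrite -[RHS]mul1r => /mulIf; apply; rewrite gt_eqF.
Qed.

Lemma boost_spin_rot0 (s t : R) : boost s *m spin_rot0 t = spin_rot0 t *m boost s.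
Proof.
rewrite mul_boost mul_spin_rot0 !mxE /=; congr mx22; rewrite ?mul0r //; exact: mulrC.
Qed.

Lemma cisN t : cis t * cis (- t) = 1 :> R[i].
Proof.
apply/eqP; rewrite eq_complex /cis cosN sinN /=; apply/andP; split; apply/eqP;
  last by ring.
by rewrite -[RHS](cos2Dsin2 t); ring.
Qed.

Lemma mul_rot1_piK g : g *m spin_rot1 pi *m spin_rot1 (- pi) = g.
Proof. by rewrite spin_rot1_Npi spin_rot1_pi !mxE /= !opprK -mx22_eta. Qed.

Lemma boost_rot0E g s t (M := g *m boost s *m spin_rot0 t) :
  [/\ M 0 0 = g 0 0 * (expR (- (s / 2)))%:C * cis (- (t / 2)),
      M 0 1 = g 0 1 * (expR (s / 2))%:C * cis (t / 2),
      M 1 0 = g 1 0 * (expR (- (s / 2)))%:C * cis (- (t / 2)) &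
      M 1 1 = g 1 1 * (expR (s / 2))%:C * cis (t / 2)].
Proof. by rewrite /M mul_spin_rot0 mul_boost; split; rewrite !mxE. Qed.

(** Mathews' formula.  For existence the data are explicit: [rho] and [theta] are read off
    from the polar form of the determinant.  For uniqueness, the geodesic has a matrix [h]
    whose columns are multiples of [k] and [k'] by its end points; a rotation about the
    geodesic turns [h] into [h'] that agrees with the inward frame of [H]. *)
Lemma lambda_length_of_spinors k k' H H' :
  spinor_horosphere k H -> spinor_horosphere k' H' -> centre H <> centre H' ->
  unique (lambda_length H H') (k 0 0 * k' 1 0 - k' 0 0 * k 1 0).
Proof.
move=> Hk Hk' cHH'; set lam := _ - _.
have [k0 dk _] := Hk; have [k0' dk' _] := Hk'.
have lam0 : lam != 0.
  apply/eqP => /eqP; rewrite subr_eq0 => l0; apply: cHH'.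
  rewrite (centre_of_spinor dk) (centre_of_spinor dk') /boundary_pt.
  move: k0 k0'; rewrite !spinor_nz !xpair_eqE !negb_and => k0 k0'.
  move: l0 k0 k0'; have [->|e] := eqVneq (k 1 0) 0; have [->|e'] := eqVneq (k' 1 0) 0;
    rewrite ?mulr0 ?orbF //=.
  - by rewrite mulf_eq0 (negbTE e') orbF => ->.
  - by rewrite eq_sym mulf_eq0 (negbTE e) orbF => ->.
  - by move/eqP=> l0 _ _; congr Some; apply/eqP; rewrite eqr_div // l0.
have H0 : 0 < sqnorm lam by exact: sqnorm_gt0.
split.
- have [t et] := polar lam0; set r := Num.sqrt _ in et.
  have r0 : 0 < r by rewrite sqrtr_gt0.
  pose h := mx22 (k 0 0) (k' 0 0 / lam) (k 1 0) (k' 1 0 / lam).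
  have dh : \det h = 1.
    by rewrite det_mx22 -[RHS](divff lam0) {3}/lam; field.
  pose s' := 2 * ln r.
  have es' : expR (s' / 2) = r by rewrite /s' mulrAC divff ?pnatr_eq0 // mul1r lnK.
  have b0 : h *m boost 0 = h.
    by rewrite mul_boost mul0r oppr0 expR0 rmorph1 !mulr1 -mx22_eta.
  have h00 : h 0 0 = k 0 0 by rewrite mxE.
  have h10 : h 1 0 = k 1 0 by rewrite mxE.
  have h01 : h 0 1 = k' 0 0 / lam by rewrite mxE.
  have h11 : h 1 1 = k' 1 0 / lam by rewrite mxE.
  have [hh wh _] := spinor_win Hk dh h00 h10.
  (* The frame after transport and rotation: its second column is [k'], so that
     turned by [pi] it is an inward frame of [H']. *)
  pose M := h *m boost s' *m spin_rot0 (2 * t).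
  have dhs : \det (h *m boost s') = 1 by exact: det_mul_boost.
  have dM : \det (M *m spin_rot1 pi) = 1.
    by rewrite det_mulmx det_spin_rot1 mulr1 det_mulmx det_spin_rot0 dhs mulr1.
  have d2 : 2 * t / 2 = t by rewrite mulrAC divff ?pnatr_eq0 // mul1r.
  have [_ M01 _ M11] := boost_rot0E h s' (2 * t);
    rewrite -/M es' d2 -mulrA -et in M01; rewrite -/M es' d2 -mulrA -et in M11.
  have {}M01 : (M *m spin_rot1 pi) 0 0 = k' 0 0.
    by rewrite spin_rot1_pi mxE M01 h01 divfK.
  have {}M11 : (M *m spin_rot1 pi) 1 0 = k' 1 0.
    by rewrite spin_rot1_pi mxE M11 h11 divfK.
  have [hM _] := spinor_win Hk' dM M01 M11.
  rewrite mul_rot1_piK point_of_rot1 point_of_rot0 in hM * => wM.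
  exists s', (2 * t); split; last first.
    by rewrite cexp_half es' mulrAC divff ?pnatr_eq0 // mul1r.
  exists (fun s => point_of (h *m boost s)), 0, s', (fun s => h *m boost s); split.
  - have -> : centre H = boundary_pt (h 0 0) (h 1 0)
      by rewrite (centre_of_spinor dk) h00 h10.
    have -> : centre H' = boundary_pt (h 0 1) (h 1 1).
      by rewrite (centre_of_spinor dk') h01 h11 ![_ / lam]mulrC boundary_pt_scale //
        invr_eq0.
    exact: geodesic_geo.
  - by rewrite b0.
  - by rewrite subr0.
  - by rewrite b0 wh; split=> //; exact: spin_parallel_geo.
  - by rewrite wM; exact: spin_rotation0.
move=> l [rho [th [[c [s [s' [P [gc [hs hs'] -> [pP Ps] rot]]]]] ->]]].
have [h [dh ec eb eb']] := geodesic_classification gc.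
have hc : c = fun s => point_of (h *m boost s) by exact/funext.
have dhs x : \det (h *m boost x) = 1 by exact: det_mul_boost.
have nz0 : (h 0 0, h 1 0) != (0, 0).
  apply/eqP => -[e0 e1]; move: dh; rewrite det2 e0 e1 mul0r mulr0 subrr => /esym/eqP.
  by rewrite oner_eq0.
have nz1 : (h 0 1, h 1 1) != (0, 0).
  apply/eqP => -[e0 e1]; move: dh; rewrite det2 e0 e1 mul0r mulr0 subrr => /esym/eqP.
  by rewrite oner_eq0.
have [mu mu0 [m0 m1]] : exists2 mu, mu != 0 & h 0 0 = mu * k 0 0 /\ h 1 0 = mu * k 1 0.
  by apply: boundary_pt_inj; rewrite -?spinor_nz // -eb (centre_of_spinor dk).
have [nu nu0 [n0 n1]] : exists2 nu, nu != 0
  & h 0 1 = nu * k' 0 0 /\ h 1 1 = nu * k' 1 0.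
  by apply: boundary_pt_inj; rewrite -?spinor_nz // -eb' (centre_of_spinor dk').
have mnl : mu * nu * lam = 1 by rewrite -dh det2 m0 m1 n0 n1 /lam; ring.
(* Where the geodesic crosses the horosphere of [k], the first column of its
   frame and [k] span the same line and give the same height: they differ by
   a phase. *)
pose em := (expR (- (s / 2)))%:C : R[i]; pose ep := (expR (s' / 2))%:C : R[i].
have [t et] : exists t, mu * em = cis t.
  apply: (spinor_normalize Hk (dhs s)); last by rewrite -ec.
    by rewrite mul_boost mxE /= m0 mulrAC.
  by rewrite mul_boost mxE /= m1 mulrAC.
have drot x y : \det (h *m boost x *m spin_rot0 y) = 1.
  by rewrite det_mulmx det_spin_rot0 dhs mulr1.
have d2 (x : R) : 2 * x / 2 = x by rewrite mulrAC divff ?pnatr_eq0 // mul1r.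
have [a0 _ a1 _] := boost_rot0E h s (2 * t).
rewrite m0 d2 (mulrAC mu) -/em et mulrAC cisN mul1r in a0.
rewrite m1 d2 (mulrAC mu) -/em et mulrAC cisN mul1r in a1.
have [_ ws _] := spinor_win Hk (drot _ _) a0 a1.
rewrite point_of_rot0 -ec in ws.
pose h' := h *m spin_rot0 (2 * t).
have dh' : \det h' = 1 by rewrite det_mulmx det_spin_rot0 dh mulr1.
have hb x : h' *m boost x = h *m boost x *m spin_rot0 (2 * t).
  by rewrite /h' -!mulmxA boost_spin_rot0.
have hc' : (fun x => point_of (h' *m boost x)) = c.
  by apply/funext => x; rewrite hb point_of_rot0 -ec.
have pQ : spin_parallel_along c (fun x => h' *m boost x).
  by have := spin_parallel_geo dh'; rewrite hc'.
have Hc (x : R) : is_derive x 1 c (row 0 (frame_of (h *m boost x))).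
  by rewrite hc; exact: is_derive_geo.
have eP : P s' = h' *m boost s'.
  by apply: (spin_parallel_unique Hc pP pQ (s0 := s)); rewrite Ps ws hb.
(* Reversed, the frame on [H'] has first column proportional to [k']; the outward
   frame of [H'] has second column [k'], which gives [q0] and [q1]. *)
pose N := h *m boost s' *m spin_rot1 pi.
have dN : \det N = 1 by rewrite det_mulmx det_spin_rot1 mulr1.
have N0 : N 0 0 = nu * ep * k' 0 0.
  by rewrite /N spin_rot1_pi mul_boost !mxE /= n0 mulrAC.
have N1 : N 1 0 = nu * ep * k' 1 0.
  by rewrite /N spin_rot1_pi mul_boost !mxE /= n1 mulrAC.
have [t' et'] : exists t', nu * ep = cis t'.
  by apply: (spinor_normalize Hk' dN N0 N1); rewrite point_of_rot1 -ec.
pose g' := N *m spin_rot0 (2 * t').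
have dg' : \det g' = 1 by rewrite det_mulmx det_spin_rot0 dN mulr1.
have g0 : g' 0 0 = k' 0 0.
  by rewrite /g' mul_spin_rot0 mxE /= N0 et' d2 mulrAC cisN mul1r.
have g1 : g' 1 0 = k' 1 0.
  by rewrite /g' mul_spin_rot0 mxE /= N1 et' d2 mulrAC cisN mul1r.
have [_ _ wo] := spinor_win Hk' dg' g0 g1.
rewrite /g' point_of_rot0 point_of_rot1 -ec -/g' in wo.
have Wrot : wout H' (c s') = P s' *m spin_rot0 th.
  apply: spin_rotation_unique rot _; apply: spin_rotation0.
  by rewrite eP; exact: det_mul_boost.
have W0 : wout H' (c s') 0 1 = k' 0 0 by rewrite wo spin_rot1_Npi mxE.
have W1 : wout H' (c s') 1 1 = k' 1 0 by rewrite wo spin_rot1_Npi mxE.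
have [_ b0 _ b1] := boost_rot0E h s' (2 * t).
have q0 : (nu * ep * (mu * em) * cis (th / 2)) * k' 0 0 = k' 0 0.
  rewrite -[RHS]W0 Wrot eP mul_spin_rot0 mxE /= hb b0 n0 d2 -/ep et; ring.
have q1 : (nu * ep * (mu * em) * cis (th / 2)) * k' 1 0 = k' 1 0.
  rewrite -[RHS]W1 Wrot eP mul_spin_rot0 mxE /= hb b1 n1 d2 -/ep et; ring.
have q : nu * ep * (mu * em) * cis (th / 2) = 1.
  move: k0'; rewrite spinor_nz xpair_eqE negb_and => /orP[]x0; apply: (mulIf x0);
    by rewrite mul1r.
rewrite cexp_half mulrBl expRD rmorphM /= -/ep -/em.
have -> : ep * em * cis (th / 2) = (mu * nu * lam) * (ep * em * cis (th / 2))
  by rewrite mnl mul1r.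
by rewrite -[LHS]mulr1 -q; ring.
Qed.

End Lambda.

(** * The spin-decorated horosphere of a spinor *)

Section Construction.
Variable R : realType.
Implicit Types (p : 'rV[R]_3) (a b c d z : R[i]) (g h : 'M[R[i]]_2) (k : 'cV[R[i]]_2).

Lemma conj_div_realc z (r : R) : (z / r%:C)^* = z^* / r%:C.
Proof. by rewrite !div_real_complex; case: z => x y /=; rewrite mulNr. Qed.

(** The lower right entry of the only matrix with first column [k] over [p]; it comes
    from [spin_frame_coords]. *)
Definition spinor_d k p : R[i] := (k 0 0 - k 1 0 * zc p)^* / (tc p)%:C.
Definition spinor_frame k p : 'M[R[i]]_2 :=
  mx22 (k 0 0) (spinor_d k p * zc p - (k 1 0)^* * (tc p)%:C) (k 1 0) (spinor_d k p).
(** Equivariance: the decoration is the second vector of the inward frame. *)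
Definition spinor_dec k p : 'rV[R]_3 := row 1 (frame_cd (k 1 0) (spinor_d k p)).

Lemma spinor_horosphere_coords k p : k != 0 ->
  horosphere (boundary_pt (k 0 0) (k 1 0)) (spinor_height k) p ->
  [/\ 0 < tc p, tc p * (sqnorm (k 1 0) + sqnorm (spinor_d k p)) = 1 &
     k 0 0 - k 1 0 * zc p = (spinor_d k p)^* * (tc p)%:C].
Proof.
move=> k0 /(horosphere_of_spinor _ k0)[t0 e]; have n0 : tc p != 0 by rewrite gt_eqF.
have nc : (tc p)%:C != 0 :> R[i] by rewrite fmorph_eq0.
split=> //; last by rewrite /spinor_d conj_div_realc conjcK divfK.
rewrite /spinor_d sqnormM sqnorm_conj -fmorphV sqnorm_realc.
move: e; move: (sqnorm _) (sqnorm (k 1 0)) => A B e.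
have -> : A = tc p - B * tc p ^+ 2 by rewrite -{1}e addrK.
by field.
Qed.

Lemma spinor_frameP k p : k != 0 -> horosphere (boundary_pt (k 0 0) (k 1 0))
  (spinor_height k) p ->
  \det (spinor_frame k p) = 1 /\ point_of (spinor_frame k p) = p.
Proof.
move=> k0 /(spinor_horosphere_coords k0)[t0 hD e].
have -> : spinor_frame k p = spin_frame_at (k 1 0) (spinor_d k p) (zc p) (tc p).
  by rewrite /spinor_frame /spin_frame_at -e [k 1 0 * _ + _]addrC subrK.
have [-> ->] := spin_frame_atP (zc p) hD; split=> //.
by apply: rV3P; rewrite /pt vecE.
Qed.

Lemma spinor_frame_of k p : k != 0 -> horosphere (boundary_pt (k 0 0) (k 1 0))
  (spinor_height k) p ->
  frame_of (spinor_frame k p) = frame_cd (k 1 0) (spinor_d k p).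
Proof.
move=> k0 hp; have [dW _] := spinor_frameP k0 hp.
by rewrite frame_ofE // !mxE.
Qed.

Lemma spinor_frame_uniq k g : \det g = 1 -> g 0 0 = k 0 0 -> g 1 0 = k 1 0 ->
  spinor_frame k (point_of g) = g.
Proof.
move=> dg e0 e1; have t0 := point_det dg.
have nc : (tc (point_of g))%:C != 0 :> R[i] by rewrite fmorph_eq0 gt_eqF.
have [ea eb] := spin_frame_coords dg.
have ed : spinor_d k (point_of g) = g 1 1.
  by rewrite /spinor_d -conj_div_realc -e0 -e1 ea [g 1 0 * _ +
    _]addrC addrK mulfK // conjcK.
by apply: mx2P; rewrite mxE /= ?ed // eb e1.
Qed.

Lemma frame_cd_cross c d : sqnorm c + sqnorm d != 0 ->
  row 2 (frame_cd c d) = (sqnorm c + sqnorm d) *: cross (row 0 (frame_cd c d)) (row 1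
    (frame_cd c d)).
Proof.
rewrite row0_frame_cd row1_frame_cd row2_frame_cd /cross /pt !vecZ !vecE.
by case: c d => [c1 c2] [d1 d2]; rewrite /sqnorm !expr2 /= => n0; congr vec; field.
Qed.

Lemma normal_of_spinor k p : k != 0 -> horosphere (boundary_pt (k 0 0) (k 1 0))
  (spinor_height k) p ->
  normal (boundary_pt (k 0 0) (k 1 0)) (spinor_height k) p = row 0 (frame_cd (k 1 0)
    (spinor_d k p)).
Proof.
move=> k0 hp; have [t0 hD e] := spinor_horosphere_coords k0 hp.
have tn : tc p != 0 by rewrite gt_eqF.
have eD : (sqnorm (k 1 0) + sqnorm (spinor_d k p)) ^- 2 = tc p ^+ 2.
  rewrite -exprVn; congr (_ ^+ 2); apply: (mulIf (_ : sqnorm (k 1 0) +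
    sqnorm (spinor_d k p) != 0)).
    by apply/eqP => e0; move: hD; rewrite e0 mulr0 => /esym/eqP; rewrite oner_eq0.
  rewrite hD mulVf //; apply/eqP => e0; move: hD; rewrite e0 mulr0 => /esym/eqP;
    by rewrite oner_eq0.
have dd : sqnorm (spinor_d k p) = (tc p)^-1 - sqnorm (k 1 0).
  by apply: (mulfI tn); rewrite mulrBr divff // -hD; ring.
rewrite row0_frame_cd eD dd /normal /boundary_pt /spinor_height.
have [c0|c0] := eqVneq (k 1 0) 0.
  by rewrite c0 (sqnorm_realc 0) expr0n mul0r conjc0 mulr0 oppr0 /pt !vecZ /=;
    congr vec; field.
have n0 : sqnorm (k 1 0) != 0 by rewrite sqnorm_eq0.
have ez : (k 1 0 * spinor_d k p)^* = (sqnorm (k 1 0))%:C * (k 0 0 / k 1 0 - zc p) /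
  (tc p)%:C.
  have nc : (tc p)%:C != 0 :> R[i] by rewrite fmorph_eq0.
  apply: (mulIf nc); rewrite divfK // rmorphM /= -mulrA -e sqnormE; field => //.
have {}ez : - (2 * (k 1 0 * spinor_d k p)^*) = (- (2 * sqnorm (k 1 0)))%:C * (k 0 0 /
  k 1 0 - zc p) / (tc p)%:C.
  by rewrite ez rmorphN rmorphM rmorph_nat; ring.
rewrite ez div_real_complex {ez}.
case: (k 0 0 / k 1 0) => u1 u2; rewrite /pt /zc /= /tc in tn *.
apply: rV3P; rewrite !vecZ !vecE !mxE /=.
all: by move: n0; move: (sqnorm (k 1 0)) => m n0; field; rewrite ?n0 ?tn.
Qed.

(** With [q = xi - eta z] the frame is polynomial in the coordinates of the point,
    because [conj d = q / t] and [D = 1 / t] on the horosphere. *)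
Lemma spinor_rows k p
    (x1 := Re (k 0 0)) (x2 := Im (k 0 0)) (e1 := Re (k 1 0)) (e2 := Im (k 1 0))
    (q1 := x1 - (e1 * p 0 0 - e2 * p 0 1))
    (q2 := x2 - (e1 * p 0 1 + e2 * p 0 0)) (t := p 0 2) :
  k != 0 -> horosphere (boundary_pt (k 0 0) (k 1 0)) (spinor_height k) p ->
  [/\ q1 ^+ 2 + q2 ^+ 2 + (e1 ^+ 2 + e2 ^+ 2) * t ^+ 2 = t,
    row 0 (frame_cd (k 1 0) (spinor_d k p)) =
      vec (- (2 * t * (e1 * q1 + e2 * q2))) (- (2 * t * (e1 * q2 - e2 * q1)))
          ((e1 ^+ 2 + e2 ^+ 2) * t ^+ 2 - q1 ^+ 2 - q2 ^+ 2),
    row 1 (frame_cd (k 1 0) (spinor_d k p)) =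
      vec (2 * e1 * e2 * t ^+ 2 - 2 * q1 * q2) ((e1 ^+ 2 - e2 ^+ 2) * t ^+ 2 +
        q1 ^+ 2 - q2 ^+ 2)
          (2 * t * (e1 * q2 + e2 * q1)) &
    row 2 (frame_cd (k 1 0) (spinor_d k p)) =
      vec (q1 ^+ 2 - q2 ^+ 2 - (e1 ^+ 2 - e2 ^+ 2) * t ^+ 2) (2 * q1 * q2 +
        2 * e1 * e2 * t ^+ 2)
          (- (2 * t * (e1 * q1 - e2 * q2)))].
Proof.
move=> k0 hp; have [t0 hD e] := spinor_horosphere_coords k0 hp.
have [_ eq] := (horosphere_of_spinor p k0).1 hp.
have tn : t != 0 by rewrite gt_eqF.
have eD : (sqnorm (k 1 0) + sqnorm (spinor_d k p)) ^- 2 = t ^+ 2.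
  have Dn : sqnorm (k 1 0) + sqnorm (spinor_d k p) != 0.
    by apply/eqP => e0; move: hD; rewrite e0 mulr0 => /esym/eqP; rewrite oner_eq0.
  by rewrite -exprVn; congr (_ ^+ 2); apply: (mulIf Dn); rewrite hD mulVf.
have ed : spinor_d k p = (q1 / t) -i* (q2 / t).
  by rewrite /spinor_d div_real_complex /q1 /q2 /x1 /x2 /e1 /e2 /t /zc /tc;
    case: (k 0 0) (k 1 0) => [? ?] [? ?] /=; rewrite mulNr.
split.
- by rewrite -[RHS]eq /q1 /q2 /x1 /x2 /e1 /e2 /t /zc /tc;
    case: (k 0 0) (k 1 0) => [? ?] [? ?]; rewrite /sqnorm /=.
- rewrite row0_frame_cd eD ed /e1 /e2 /pt vecZ; move: tn; case: (k 1 0) => a b;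
    rewrite /sqnorm !expr2 /= => tn; congr vec; field => //.
- rewrite row1_frame_cd eD ed /e1 /e2 /pt vecZ; move: tn; case: (k 1 0) => a b;
    rewrite /sqnorm !expr2 /= => tn; congr vec; field => //.
- rewrite row2_frame_cd eD ed /e1 /e2 /pt vecZ; move: tn; case: (k 1 0) => a b;
    rewrite /sqnorm !expr2 /= => tn; congr vec; field => //.
Qed.

Lemma frame_decompose (F : 'M[R]_3) (tau : R) (X : 'rV[R]_3) : tau != 0 ->
  F *m F^T = tau%:M -> tau *: X =
    dot X (row 0 F) *: row 0 F + dot X (row 1 F) *: row 1 F +
      dot X (row 2 F) *: row 2 F.
Proof.
move=> tau0 FF.
have FF' := trmx_orthonormal tau0 FF.
have l1 : lift ord0 ord0 = 1 :> 'I_3 by exact: val_inj.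
have l2 : lift ord0 (lift ord0 ord0) = 2 :> 'I_3 by exact: val_inj.
rewrite -mul_mx_scalar -FF' mulmxA mulmx_sum_row !big_ord_recl big_ord0 addr0.
have E j : (X *m F^T) 0 j = dot X (row j F).
  by rewrite dotE mxE !big_ord_recl big_ord0 addr0 l1 l2 !mxE addrA.
by rewrite !E addrA l1 l2.
Qed.


Lemma spinor_frame_orthonormal k p : k != 0 ->
  horosphere (boundary_pt (k 0 0) (k 1 0)) (spinor_height k) p ->
  frame_cd (k 1 0) (spinor_d k p) *m (frame_cd (k 1 0) (spinor_d k p))^T = (tc p ^+
    2)%:M.
Proof.
move=> k0 hp; have [dW pW] := spinor_frameP k0 hp.
by rewrite -spinor_frame_of // frame_orthonormal // pW.
Qed.

(** The velocity [X] of a curve in the horosphere is a combination of the two tangent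
    vectors of the frame, with coefficients [al] and [be].  The horosphere is umbilic, so the
    derivative of the decoration has normal component [- al], and what remains is a polynomial
    identity modulo the equation of the horosphere. *)
Lemma spinor_dec_parallel k : k != 0 ->
  parallel_unit_tangent_field (boundary_pt (k 0 0) (k 1 0)) (spinor_height k)
    (spinor_dec k).
Proof.
move=> k0; split=> [p hp|c hc s].
  rewrite normal_of_spinor // /spinor_dec -!mul_trmx_dot spinor_frame_orthonormal //.
  by rewrite !mxE.
have hp x : horosphere (boundary_pt (k 0 0) (k 1 0)) (spinor_height k) (c x)
  by have [] := hc x.
have Hc (x : R) : is_derive x 1 c (derive1 c x).
  by have [_ dc] := hc x; rewrite derive1E; exact/derivableP.
have Hj j := is_derive_coord j (Hc s).
pose e1 := Re (k 1 0); pose e2 := Im (k 1 0).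
pose q1 x := Re (k 0 0) - (e1 * c x 0 0 - e2 * c x 0 1).
pose q2 x := Im (k 0 0) - (e1 * c x 0 1 + e2 * c x 0 0).
pose t x := c x 0 2.
pose X := derive1 c s; set X0 := X 0 0; set X1 := X 0 1; set X2 := X 0 2.
have [G _ _ _] := spinor_rows k0 (hp s).
have eV : spinor_dec k \o c = fun x =>
    vec (2 * e1 * e2 * (t x * t x) - 2 * (q1 x * q2 x))
        ((e1 ^+ 2 - e2 ^+ 2) * (t x * t x) + q1 x * q1 x - q2 x * q2 x)
        (2 * (t x * (e1 * q2 x + e2 * q1 x))).
  apply/funext => x; rewrite /comp /spinor_dec;
    have [_ _ -> _] := spinor_rows k0 (hp x).
  by congr vec; rewrite -/e1 -/e2 -/(q1 x) -/(q2 x) -/(t x); ring.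
have cst (r : R) : is_derive s 1 (fun=> r) 0 by exact: is_derive_cst.
have H0 : is_derive s 1 (fun x => c x 0 0) X0 by exact: Hj.
have H1 : is_derive s 1 (fun x => c x 0 1) X1 by exact: Hj.
have Ht : is_derive s 1 t X2 by exact: Hj.
pose dq1 := - (e1 * X0 - e2 * X1); pose dq2 := - (e1 * X1 + e2 * X0).
have Hq1 : is_derive s 1 q1 dq1.
  have := is_deriveBR (cst (Re (k 0 0))) (is_deriveBR (is_deriveMR (cst e1) H0)
    (is_deriveMR (cst e2) H1)).
  by move/is_derive_eq; apply; rewrite /dq1; ring.
have Hq2 : is_derive s 1 q2 dq2.
  have := is_deriveBR (cst (Im (k 0 0))) (is_deriveDR (is_deriveMR (cst e1) H1)
    (is_deriveMR (cst e2) H0)).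
  by move/is_derive_eq; apply; rewrite /dq2; ring.
have HV : is_derive s 1 (spinor_dec k \o c)
   (vec (2 * e1 * e2 * (2 * t s * X2) - 2 * (dq1 * q2 s + q1 s * dq2))
        ((e1 ^+ 2 - e2 ^+ 2) * (2 * t s * X2) + 2 * q1 s * dq1 - 2 * q2 s * dq2)
        (2 * (X2 * (e1 * q2 s + e2 * q1 s) + t s * (e1 * dq2 + e2 * dq1)))).
  rewrite eV; set v := vec _ _ _.
  have -> : (fun x => vec (2 * e1 * e2 * (t x * t x) - 2 * (q1 x * q2 x))
        ((e1 ^+ 2 - e2 ^+ 2) * (t x * t x) + q1 x * q1 x - q2 x * q2 x)
        (2 * (t x * (e1 * q2 x + e2 * q1 x)))) = (fun x => 1 *: vec (2 * e1 * e2 * (t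
          x * t x) - 2 * (q1 x * q2 x))
        ((e1 ^+ 2 - e2 ^+ 2) * (t x * t x) + q1 x * q1 x - q2 x * q2 x)
        (2 * (t x * (e1 * q2 x + e2 * q1 x)))).
    by apply/funext => x; rewrite scale1r.
  have Htt := is_deriveMR Ht Ht.
  apply: is_derive_scaled_vec.
  - have := is_deriveMR (cst 1) (is_deriveBR (is_deriveMR (cst (2 * e1 * e2)) Htt)
      (is_deriveMR (cst 2) (is_deriveMR Hq1 Hq2))).
    by move/is_derive_eq; apply; ring.
  - have := is_deriveMR (cst 1) (is_deriveBR (is_deriveDR (is_deriveMR (cst (e1 ^+ 2 -
      e2 ^+ 2)) Htt) (is_deriveMR Hq1 Hq1)) (is_deriveMR Hq2 Hq2)).
    by move/is_derive_eq; apply; ring.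
  - have := is_deriveMR (cst 1) (is_deriveMR (cst 2) (is_deriveMR Ht (is_deriveDR
      (is_deriveMR (cst e1) Hq2) (is_deriveMR (cst e2) Hq1)))).
    by move/is_derive_eq; apply; ring.
split; first by have [] := HV.
have [_ rN rV rW] := spinor_rows k0 (hp s).
have [tp _] := (horosphere_of_spinor _ k0).1 (hp s).
have tn : t s != 0 by rewrite gt_eqF.
rewrite -/e1 -/e2 -/(q1 s) -/(q2 s) -/(t s) in G rN rV rW.
(* The derivative of the equation of the horosphere. *)
have dG : 2 * q1 s * dq1 + 2 * q2 s * dq2 +
    (e1 ^+ 2 + e2 ^+ 2) * (2 * t s * X2) - X2 = 0.
  have := is_deriveBR (is_deriveDR (is_deriveDR (is_deriveMR Hq1 Hq1) (is_deriveMR Hq2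
    Hq2))
     (is_deriveMR (cst (e1 ^+ 2 + e2 ^+ 2)) (is_deriveMR Ht Ht))) Ht.
  have -> : (fun x => q1 x * q1 x + q2 x * q2 x + (e1 ^+ 2 +
    e2 ^+ 2) * (t x * t x) - t x) = (fun=> 0).
    apply/funext => x; have [Gx _ _ _] := spinor_rows k0 (hp x).
    by rewrite -/e1 -/e2 -/(q1 x) -/(q2 x) -/(t x) in Gx;
      rewrite -[t x in X in _ - X]Gx; ring.
  move=> D; rewrite -[RHS](@derive_val _ _ _ _ _ _ _ (cst 0)) (@derive_val _ _ _ _ _ _
    _ D).
  by ring.
set F := frame_cd _ _ in rN rV rW.
have XN : dot X (row 0 F) = 0.
  rewrite rN dotE !vecE -/X0 -/X1 -/X2.
  transitivity (X2 * (t s - (q1 s ^+ 2 + q2 s ^+ 2 + (e1 ^+ 2 + e2 ^+ 2) * t s ^+ 2)) +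
     t s * (2 * q1 s * dq1 + 2 * q2 s * dq2 + (e1 ^+ 2 +
       e2 ^+ 2) * (2 * t s * X2) - X2)).
    by rewrite /dq1 /dq2; ring.
  by rewrite dG G subrr !mulr0 addr0.
have t2 : t s ^+ 2 != 0 by rewrite expf_neq0.
have := frame_decompose X t2 (spinor_frame_orthonormal k0 (hp s)).
rewrite -/F XN scale0r add0r.
pose al := dot X (row 1 F) / t s ^+ 2; pose be := dot X (row 2 F) / t s ^+ 2.
have hal : dot X (row 1 F) = t s ^+ 2 * al by rewrite mulrC divfK.
have hbe : dot X (row 2 F) = t s ^+ 2 * be by rewrite mulrC divfK.
move=> eX0; have eX : X = al *: row 1 F + be *: row 2 F.
  by apply: (scalerI t2); rewrite eX0 hal hbe scalerDr !scalerA.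
exists (- al); rewrite normal_of_spinor // -/F /cov derive1E (@derive_val _ _ _ _ _ _
  _ HV).
rewrite -/X (_ : (spinor_dec k \o c) s = row 1 F) // hal rN.
move: eX; rewrite rV rW !vecZ vecD => eX.
have x0 : X0 = _ := etrans (congr1 (fun v : 'rV_3 => v 0 0) eX) (vec0 _ _ _).
have x1 : X1 = _ := etrans (congr1 (fun v : 'rV_3 => v 0 1) eX) (vec1 _ _ _).
have x2 : X2 = _ := etrans (congr1 (fun v : 'rV_3 => v 0 2) eX) (vec2 _ _ _).
have eXv : X = vec X0 X1 X2 := vec_eta X.
rewrite (_ : tc X = X2) // -[tc (c s)]/(t s) tc_vec [in LHS]eXv !vecZ vecD vecB vecZ
  vecB.
have G1 : q1 s ^+ 2 = t s - q2 s ^+ 2 - (e1 ^+ 2 + e2 ^+ 2) * t s ^+ 2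
  by rewrite -{1}G; ring.
congr vec; apply: (mulfI tn); rewrite [LHS]mulrBr mulVKf // /dq1 /dq2 x0 x1 x2;
  ring: G1.
Qed.


Lemma continuous_zc : continuous (@zc R).
Proof. by move=> p; apply: continuous_cplx; exact: coord_continuous. Qed.

Lemma continuous_zc_conj : continuous (fun p : 'rV[R]_3 => (zc p)^*).
Proof.
move=> p; apply: (@continuous_cplx _ _ (fun p : 'rV[R]_3 => p 0 0) (fun p : 'rV[R]_3
  => - p 0 1)).
  exact: coord_continuous.
by apply: continuousN; exact: coord_continuous.
Qed.

Lemma continuous_tcC : continuous (fun p : 'rV[R]_3 => (tc p)%:C).
Proof. by move=> p; apply: (@continuous_realc _ _ (@tc R));
  exact: coord_continuous. Qed.

Lemma continuous_spinor_d k p : tc p != 0 -> {for p, continuous (spinor_d k)}.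
Proof.
move=> t0; have cst z : {for p, continuous (fun=> z : R[i])} by exact: cst_continuous.
have -> : spinor_d k = fun p => ((k 0 0)^* +
  (- (k 1 0)^*) * (zc p)^*) * (((tc p)^-1)%:C).
  by apply/funext => x; rewrite /spinor_d rmorphB rmorphM mulNr -fmorphV.
apply: continuous_cM.
  apply: continuous_cD; first exact: cst.
  by apply: continuous_cM; [exact: cst|exact: continuous_zc_conj].
apply: (@continuous_realc _ _ (fun p : 'rV[R]_3 => (tc p)^-1)).
have ct : {for p, continuous (@tc R)} by exact: coord_continuous.
by exact: (@cvgV R 'rV[R]_3 (nbhs p) _ (@tc R) (tc p) t0 ct).
Qed.

Lemma continuous_spinor_frame k p : tc p != 0 -> {for p, continuous (spinor_frame k)}.
Proof.
move=> t0; have cst z : {for p, continuous (fun=> z : R[i])} by exact: cst_continuous.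
have cd := continuous_spinor_d (k := k) t0.
have cb : {for p, continuous (fun p => spinor_d k p * zc p - (k 1 0)^* * (tc p)%:C)}.
  apply: continuous_cD; first by apply: continuous_cM; [exact: cd|exact: continuous_zc].
  by apply: continuous_cN; apply: continuous_cM; [exact: cst|exact: continuous_tcC].
exact: (continuous_mx22 (cst (k 0 0)) cb (cst (k 1 0)) cd).
Qed.

Section SpinorHorosphere.
Variables (k : 'cV[R[i]]_2) (k0 : k != 0).
Let b := boundary_pt (k 0 0) (k 1 0).
Let d := spinor_height k.

Lemma spinor_height_gt0 : 0 < d.
Proof.
rewrite /d /spinor_height; have := k0; rewrite spinor_nz xpair_eqE negb_and.
have [_|e0] := eqVneq (k 1 0) 0; first by rewrite orbF => /sqnorm_gt0.
by rewrite invr_gt0 sqnorm_gt0.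
Qed.

Lemma spinor_frame_NV p : horosphere b d p ->
  frame_of (spinor_frame k p) = frame_NV p (normal b d p) (spinor_dec k p).
Proof.
move=> hp; rewrite spinor_frame_of // normal_of_spinor // /spinor_dec.
have [t0 hD _] := spinor_horosphere_coords k0 hp.
have Dn : sqnorm (k 1 0) + sqnorm (spinor_d k p) != 0.
  by apply/eqP => e0; move: hD; rewrite e0 mulr0 => /esym/eqP; rewrite oner_eq0.
rewrite /frame_NV; apply: row3P; rewrite row_frameE // frame_cd_cross //.
congr (_ *: _); apply: (mulfI (lt0r_neq0 t0)); rewrite hD divff // gt_eqF //.
Qed.

Lemma spinor_frame_NV_out p : horosphere b d p ->
  frame_of (spinor_frame k p *m spin_rot1 (- pi)) =
    frame_NV p (- normal b d p) (spinor_dec k p).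
Proof.
move=> hp; have [dW _] := spinor_frameP k0 hp.
rewrite frame_of_rot1 // spinor_frame_NV //; set F := frame_NV _ _ _.
have [r0 r1 r2] := row_rotate1 (- pi) F; apply: row3P;
  rewrite ?(r0, r1, r2) ?cosN ?sinN ?cospi ?sinpi.
- by rewrite oppr0 scale0r subr0 /F /frame_NV !row_frameE scaleN1r.
- by rewrite /F /frame_NV !row_frameE.
- rewrite oppr0 scale0r addr0 /F /frame_NV !row_frameE scaleN1r -scalerN;
    congr (_ *: _).
  by rewrite /cross; apply: rV3P; rewrite ?mxE ?vecE ?mxE /=; ring.
Qed.

Lemma spinor_continuous_on (f : 'rV[R]_3 -> 'M[R[i]]_2) :
  (forall p, tc p != 0 -> {for p, continuous f}) ->
    {within horosphere b d, continuous f}.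
Proof.
move=> cf; apply: continuous_in_subspaceT => p; rewrite inE => hp; apply: cf.
by have [t0 _ _] := spinor_horosphere_coords k0 hp; rewrite gt_eqF.
Qed.

Lemma spinor_win_lift : spin_lift (horosphere b d)
  (fun p => frame_NV p (normal b d p) (spinor_dec k p)) (spinor_frame k).
Proof.
split; first by apply: spinor_continuous_on => p; exact: continuous_spinor_frame.
move=> p hp; have [dW pW] := spinor_frameP k0 hp.
by split=> //; [rewrite inE | exact: spinor_frame_NV].
Qed.

Lemma spinor_wout_lift : spin_lift (horosphere b d)
  (fun p => frame_NV p (- normal b d p) (spinor_dec k p)) (fun p => spinor_frame k p
    *m spin_rot1 (- pi)).
Proof.
split.
  apply: spinor_continuous_on => p t0.
  have cd := continuous_spinor_d (k := k) t0.
  have -> : (fun p => spinor_frame k p *m spin_rot1 (- pi)) = fun p => mx22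
      (- spinor_frame k p 0 1) (spinor_frame k p 0 0) (- spinor_frame k p 1 1)
        (spinor_frame k p 1 0).
    by apply/funext => x; rewrite spin_rot1_Npi.
  have ce i j : {for p, continuous (fun p => spinor_frame k p i j)}.
    apply: (@continuous_comp _ _ _ (spinor_frame k) (fun M => M i j));
      last exact: continuous_entry.
    exact: continuous_spinor_frame.
  exact: (continuous_mx22 (continuous_cN (ce 0 1)) (ce 0 0) (continuous_cN (ce 1 1))
    (ce 1 0)).
move=> p hp; have [dW pW] := spinor_frameP k0 hp; split.
- by rewrite inE /spin_frame /= det_mulmx dW det_spin_rot1 mulr1.
- by rewrite point_of_rot1.
- exact: spinor_frame_NV_out.
Qed.

Lemma spinor_win_wout p : horosphere b d p ->
  spin_rotation 1 (- pi) (spinor_frame k p) (spinor_frame k p *m spin_rot1 (- pi)).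
Proof. by move=> hp; have [dW pW] := spinor_frameP k0 hp; exact: spin_rotation1. Qed.

Definition horosphere_of : spin_decorated_horosphere R :=
  SpinDecoratedHorosphere spinor_height_gt0 (spinor_dec_parallel k0)
    spinor_win_lift spinor_wout_lift spinor_win_wout.

Lemma horosphere_ofP : spinor_horosphere k horosphere_of.
Proof.
split=> //; last first.
  move=> g; rewrite inE => dg ek; apply: spinor_frame_uniq => //.
    by rewrite -ek mxE.
  by rewrite -ek mxE.
rewrite /decoration_of_spinor /=.
have [e0|e0] := eqVneq (k 1 0) 0.
  split=> [||p hp]; [by rewrite /boundary_pt e0 eqxx|by rewrite /d /spinor_height e0
    eqxx|].
  have hp' : horosphere b d p := hp.
  have [_ _ rV _] := spinor_rows k0 hp'; rewrite /spinor_dec rV e0 /pt.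
  by case: (k 0 0) => x1 x2; rewrite expr2 /=; congr vec; ring.
rewrite /d /boundary_pt /spinor_height (negbTE e0); split=> //.
have n0 : sqnorm (k 1 0) != 0 by rewrite sqnorm_eq0.
have ed : spinor_d k (pt (k 0 0 / k 1 0) (sqnorm (k 1 0))^-1) = 0.
  by rewrite /spinor_d zc_pt [k 1 0 * _]mulrC divfK // subrr conjc0 mul0r.
rewrite /spinor_dec row1_frame_cd ed conjc0 expr0n addr0 mulr0 (sqnorm_realc 0) expr0n
  addr0.
rewrite div_complexE sqnorm_sqr div_real_complex rmorphXn /pt vecZ mulr0 mulr0.
by congr vec; rewrite mulrC.
Qed.
End SpinorHorosphere.

End Construction.

(** * The orbit of the figure eight knot group *)

Section Eisenstein.
Variable R : realType.
Implicit Types (a b c d x y z u : R[i]) (g h : 'M[R[i]]_2).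
Local Notation w := (omega R).
Local Notation G := (@figure_eight_group R).

Lemma omega_sqr : w ^+ 2 = -1 - w.
Proof.
rewrite /omega; apply/eqP; rewrite eq_complex /=; apply/andP; split; apply/eqP;
  last by field.
have s3 : Num.sqrt 3 * Num.sqrt 3 = 3 :> R by rewrite -expr2 sqr_sqrtr.
transitivity (1 / 4 - (Num.sqrt 3 * Num.sqrt 3) / 4 : R); first by field.
by rewrite s3; field.
Qed.

Lemma eisenstein_int (m : int) : eisenstein (m%:~R : R[i]).
Proof. by exists m, 0; rewrite mul0r addr0. Qed.

Lemma eisenstein_omega : eisenstein w.
Proof. by exists 0, 1; rewrite mul1r add0r. Qed.

Lemma eisensteinN a : eisenstein a -> eisenstein (- a).
Proof. by move=> [m [n ->]]; exists (- m), (- n); rewrite !rmorphN /= mulNr opprD. Qed.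

Lemma eisensteinD a b : eisenstein a -> eisenstein b -> eisenstein (a + b).
Proof.
move=> [m [n ->]] [m' [n' ->]]; exists (m + m'), (n + n'); rewrite !rmorphD /=; ring.
Qed.

Lemma eisensteinM a b : eisenstein a -> eisenstein b -> eisenstein (a * b).
Proof.
move=> [m [n ->]] [m' [n' ->]]; exists (m * m' - n * n'), (m * n' + n * m' - n * n').
rewrite !(rmorphB, rmorphD, rmorphM) /=; ring: omega_sqr.
Qed.

Lemma eisenstein_unitM a b : eisenstein_unit a -> eisenstein_unit b ->
  eisenstein_unit (a * b).
Proof.
move=> [ea [a' [ea' aa']]] [eb [b' [eb' bb']]]; split; first exact: eisensteinM.
by exists (a' * b'); split; [exact: eisensteinM | rewrite mulrACA aa' bb' mulr1].
Qed.

Lemma eisenstein_unitN a : eisenstein_unit a -> eisenstein_unit (- a).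
Proof.
move=> [ea [a' [ea' aa']]]; split; first exact: eisensteinN.
by exists (- a'); split; [exact: eisensteinN | rewrite mulrNN].
Qed.

Lemma eisenstein_unit_omega : eisenstein_unit w.
Proof.
split; first exact: eisenstein_omega.
exists (w ^+ 2); split; first by rewrite expr2; apply: eisensteinM;
  exact: eisenstein_omega.
ring: omega_sqr.
Qed.

Lemma eisenstein_unit_neq0 u : eisenstein_unit u -> u != 0.
Proof.
by move=> [_ [v [_ uv]]]; apply/eqP => u0; move: uv; rewrite u0 mul0r => /esym/eqP;
  rewrite oner_eq0.
Qed.

Lemma mulE_mx22 g a b c d : g * mx22 a b c d = g *m mx22 a b c d. Proof. by []. Qed.

Lemma inv_mx22 g : \det g = 1 -> g^-1 = mx22 (g 1 1) (- g 0 1) (- g 1 0) (g 0 0).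
Proof.
move=> dg; have Ug : g \is a GRing.unit by rewrite unitmxE dg unitr1.
apply: (mulrI Ug); rewrite divrr // mulE_mx22 mul_mx22.
have d1 := dg; rewrite det2 in d1.
by apply: mx2P; rewrite !mxE /=; [rewrite -d1|idtac|idtac|rewrite -d1]; ring.
Qed.

(** An overgroup of the figure eight group. *)
Definition eisenstein_SL2 : set 'M[R[i]]_2 :=
  [set g | \det g = 1 /\ forall i j, eisenstein (g i j)].

Lemma eisenstein_SL2_subgroup : subgroup_SL2 eisenstein_SL2.
Proof.
split.
- by move=> g [].
- split; first by rewrite det1.
  move=> i j; rewrite mxE; case: (i == j);
    [exact: (eisenstein_int 1)|exact: (eisenstein_int 0)].
- move=> g h [dg eg] [dh eh]; split; first by rewrite det_mulmx dg dh mulr1.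
  rewrite (mx22_eta h) mulE_mx22 mul_mx22.
  by apply: ord2P; apply: ord2P; rewrite mxE; apply: eisensteinD; apply: eisensteinM;
    rewrite ?mxE.
- move=> g [dg eg]; rewrite inv_mx22 //; split.
    by rewrite det_mx22 -dg det2; ring.
  by apply: ord2P; apply: ord2P; rewrite mxE /=; (exact: eg || exact: eisensteinN).
Qed.

Lemma figure_eight_eisenstein g : G g -> \det g = 1 /\ forall i j, eisenstein (g i j).
Proof.
move=> Gg; apply: (Gg eisenstein_SL2); split; first exact: eisenstein_SL2_subgroup.
have e0 := eisenstein_int 0; have e1 := eisenstein_int 1.
by move=> _ [->|->]; (split; first by rewrite det_mx22; ring); apply: ord2P;
  apply: ord2P;
  rewrite mxE //=; apply: eisensteinN; exact: eisenstein_omega.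
Qed.

Lemma figure_eight1 : G 1.
Proof. by move=> S [[_ S1 _ _] _]. Qed.
Lemma figure_eightM g h : G g -> G h -> G (g *m h).
Proof. by move=> Gg Gh S HS; have [[_ _ SM _] _] := HS; apply: SM;
  [exact: Gg|exact: Gh]. Qed.
Lemma figure_eightV g : G g -> G (mx22 (g 1 1) (- g 0 1) (- g 1 0) (g 0 0)).
Proof.
move=> Gg; have [dg _] := figure_eight_eisenstein Gg; rewrite -inv_mx22 // => S HS.
by have [[_ _ _ SV] _] := HS; apply: SV; exact: Gg.
Qed.
Lemma figure_eightA : G (mx22 1 1 0 1).
Proof. by move=> S [_ SAB]; apply: SAB; left. Qed.
Lemma figure_eightB : G (mx22 1 0 (- w) 1).
Proof. by move=> S [_ SAB]; apply: SAB; right. Qed.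
Lemma figure_eightA' : G (mx22 1 (-1) 0 1).
Proof. by have := figure_eightV figure_eightA; rewrite !mxE /= oppr0. Qed.
Lemma figure_eightB' : G (mx22 1 0 w 1).
Proof. by have := figure_eightV figure_eightB; rewrite !mxE /= opprK oppr0. Qed.

Definition orbit_e1 x y : Prop := exists2 g, G g & g 0 0 = x /\ g 1 0 = y.

Lemma orbit_e1_1 : orbit_e1 1 0.
Proof. by exists 1; [exact: figure_eight1 | rewrite !mxE]. Qed.

Lemma orbit_e1M a b c d x y : G (mx22 a b c d) -> orbit_e1 x y ->
  orbit_e1 (a * x + b * y) (c * x + d * y).
Proof.
move=> Gh [g Gg [<- <-]]; exists (mx22 a b c d *m g); first exact: figure_eightM.
by rewrite !mulmx2E !mxE.
Qed.

(** The orbit is explored by applying the generators from right to left; this lemma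
    normalises the resulting coordinates. *)
Lemma orbit_e1_eq x y x' y' : orbit_e1 x y -> x = x' -> y = y' -> orbit_e1 x' y'.
Proof. by move=> ? <- <-. Qed.

Lemma orbit_e1_A x y : orbit_e1 x y -> orbit_e1 (x + y) y.
Proof. by move/(orbit_e1M figure_eightA)/orbit_e1_eq; apply; ring. Qed.
Lemma orbit_e1_A' x y : orbit_e1 x y -> orbit_e1 (x - y) y.
Proof. by move/(orbit_e1M figure_eightA')/orbit_e1_eq; apply; ring. Qed.
Lemma orbit_e1_B x y : orbit_e1 x y -> orbit_e1 x (y - w * x).
Proof. by move/(orbit_e1M figure_eightB)/orbit_e1_eq; apply; ring. Qed.
Lemma orbit_e1_B' x y : orbit_e1 x y -> orbit_e1 x (y + w * x).
Proof. by move/(orbit_e1M figure_eightB')/orbit_e1_eq; apply; ring. Qed.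

(** The longitude [B A^-1 B^-1 A A B^-1 A^-1 B] is minus the translation by [2 + 4 omega]. *)
Lemma orbit_e1_longitude x y : orbit_e1 x y -> orbit_e1 (- x - (2 + 4 * w) * y) (- y).
Proof.
move/orbit_e1_B/orbit_e1_A'/orbit_e1_B'/orbit_e1_A.
move/orbit_e1_A/orbit_e1_B'/orbit_e1_A'/orbit_e1_B/orbit_e1_eq.
by apply; ring: omega_sqr.
Qed.
Lemma orbit_e1_longitude' x y : orbit_e1 x y -> orbit_e1 (- x + (2 + 4 * w) * y) (- y).
Proof.
move/orbit_e1_B'/orbit_e1_A/orbit_e1_B/orbit_e1_A'.
move/orbit_e1_A'/orbit_e1_B/orbit_e1_A/orbit_e1_B'/orbit_e1_eq.
by apply; ring: omega_sqr.
Qed.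

(** The unit accounts for the orbit of [(1, 0)] being smaller than the set of all
    coordinate vectors of its cusps. *)
Definition orbit_ratio x : Prop := exists2 u, eisenstein_unit u & orbit_e1 (u * x) u.

Lemma orbit_ratioD1 x : orbit_ratio x -> orbit_ratio (x + 1).
Proof. by move=> [u Uu ou]; exists u => //; apply: (orbit_e1_eq (orbit_e1_A ou));
  ring. Qed.
Lemma orbit_ratioB1 x : orbit_ratio x -> orbit_ratio (x - 1).
Proof. by move=> [u Uu ou]; exists u => //; apply: (orbit_e1_eq (orbit_e1_A' ou));
  ring. Qed.
Lemma orbit_ratio_longitude x : orbit_ratio x -> orbit_ratio (x + (2 + 4 * w)).
Proof.
move=> [u Uu ou]; exists (- u); first exact: eisenstein_unitN.
by apply: (orbit_e1_eq (orbit_e1_longitude ou)) => //; ring.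
Qed.
Lemma orbit_ratio_longitude' x : orbit_ratio x -> orbit_ratio (x - (2 + 4 * w)).
Proof.
move=> [u Uu ou]; exists (- u); first exact: eisenstein_unitN.
by apply: (orbit_e1_eq (orbit_e1_longitude' ou)) => //; ring.
Qed.

Lemma orbit_ratio_translate (t : R[i]) : (forall x, orbit_ratio x ->
  orbit_ratio (x + t)) ->
  (forall x, orbit_ratio x -> orbit_ratio (x - t)) ->
    forall (q : int) x, orbit_ratio x -> orbit_ratio (x + q%:~R * t).
Proof.
move=> hp hm [] n x rx.
  elim: n => [|n IH]; first by rewrite mul0r addr0.
  have -> : x + n.+1%:~R * t = x + n%:~R * t + t by rewrite -addn1 PoszD rmorphD /=;
    ring.
  exact: hp.
rewrite NegzE rmorphN /=; elim: n => [|n IH]; first by rewrite mulN1r; exact: hm.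
have -> : x + - n.+2%:~R * t = x + - n.+1%:~R * t - t.
  by rewrite -(addn1 n.+1) PoszD rmorphD /=; ring.
exact: hm.
Qed.

Lemma unit_omega2 : eisenstein_unit (-1 - w).
Proof. by rewrite -omega_sqr expr2; apply: eisenstein_unitM;
  exact: eisenstein_unit_omega. Qed.

(** The words [A B^-1], [A B^-1 A^-1 B], [A^-1 B] and [A^-1 B A^-1 B^-1] give the
    four representatives. *)
Lemma orbit_ratio_omegaN : orbit_ratio (- w).
Proof.
exists w; first exact: eisenstein_unit_omega.
by have /orbit_e1_B'/orbit_e1_A/orbit_e1_eq := orbit_e1_1; apply; ring: omega_sqr.
Qed.
Lemma orbit_ratio0 : orbit_ratio 0.
Proof.
exists (-1 - w); first exact: unit_omega2.
by have /orbit_e1_B/orbit_e1_A'/orbit_e1_B'/orbit_e1_A/orbit_e1_eq := orbit_e1_1;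
  apply; ring: omega_sqr.
Qed.
Lemma orbit_ratio_omega : orbit_ratio w.
Proof.
exists (- w); first by apply: eisenstein_unitN; exact: eisenstein_unit_omega.
by have /orbit_e1_B/orbit_e1_A'/orbit_e1_eq := orbit_e1_1; apply; ring: omega_sqr.
Qed.
Lemma orbit_ratio_2omega : orbit_ratio (2 * w).
Proof.
exists (-1 - w); first exact: unit_omega2.
by have /orbit_e1_B'/orbit_e1_A'/orbit_e1_B/orbit_e1_A'/orbit_e1_eq := orbit_e1_1;
  apply; ring: omega_sqr.
Qed.

(** Write [n = r + 4 q] with [r] in [{-1, 0, 1, 2}]; the longitude changes [n] by 4. *)
Lemma orbit_ratio_eisenstein x : eisenstein x -> orbit_ratio x.
Proof.
move=> [m [n ->]].
have H (r q : int) : n = r + q * 4 -> orbit_ratio (r%:~R * w) ->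
  orbit_ratio (m%:~R + n%:~R * w).
  move=> -> /(orbit_ratio_translate orbit_ratio_longitude orbit_ratio_longitude'
    q)/(orbit_ratio_translate orbit_ratioD1 orbit_ratioB1 (m - 2 * q)).
  congr orbit_ratio; rewrite !(rmorphB, rmorphD, rmorphM) /=; ring.
have := divz_eq n 4; have := ltz_pmod n (isT : 0 < 4 :> int);
  have := modz_ge0 n (isT : 4 != 0 :> int).
rewrite addrC => m0 m4 e; have {}e : n = (n %% 4)%Z + (n %/ 4)%Z * 4
  by rewrite {1}e addrC.
move: (n %/ 4)%Z (n %% 4)%Z m0 m4 e => q [] // [|[|[|[|//]]]] _ _ e.
- by apply: (H 0 q); rewrite // mul0r; exact: orbit_ratio0.
- by apply: (H 1 q); rewrite // mul1r; exact: orbit_ratio_omega.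
- by apply: (H 2 q) => //; exact: orbit_ratio_2omega.
(* [3 omega] is replaced by [- omega]. *)
- apply: (H (-1) (q + 1)); first by rewrite e; ring.
  by rewrite rmorphN mulN1r; exact: orbit_ratio_omegaN.
Qed.

(** The word [A B^-1 A^-1 B] takes [u (x, 1)] to [- omega u (1, a)] for the
    [x = (-1 - omega) (2 + omega - a)] used here. *)
Lemma orbit_second_coordinate x : eisenstein x ->
  exists u, eisenstein_unit u /\ orbit_e1 u (u * x).
Proof.
move=> ex; have e1 := eisenstein_int 1; have ew := eisenstein_omega.
have [u Uu ou] : orbit_ratio ((-1 - w) * (2 + w - x)).
  apply: orbit_ratio_eisenstein; apply: eisensteinM.
    by apply: eisensteinD; [exact: eisensteinN|exact: eisensteinN].
  by apply: eisensteinD; [apply: eisensteinD => //;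
    exact: (eisenstein_int 2)|exact: eisensteinN].
exists (- (w * u)); split.
  by apply: eisenstein_unitN; apply: eisenstein_unitM => //;
    exact: eisenstein_unit_omega.
by have /orbit_e1_B/orbit_e1_A'/orbit_e1_B'/orbit_e1_A/orbit_e1_eq := ou; apply;
  ring: omega_sqr.
Qed.

End Eisenstein.

(** * The lambda-lengths of the figure eight knot *)

Theorem theorem1p2 (R : realType) :
  (forall H H' : spin_decorated_horosphere R,
     figure_eight_horosphere H -> figure_eight_horosphere H' ->
     centre H <> centre H' ->
     exists l : R[i], unique (lambda_length H H') l /\ eisenstein l)
  /\
  (forall a : R[i], eisenstein a -> a <> 0 ->
     exists u : R[i], eisenstein_unit u /\
     exists H H' : spin_decorated_horosphere R,
       [/\ figure_eight_horosphere H, figure_eight_horosphere H',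
           centre H <> centre H' & unique (lambda_length H H') (u * a)]).
Proof.
have e1E (g : 'M[R[i]]_2) : forall i, (g *m (\col_(i < 2) [:: 1; 0]`_i)) i 0 = g i 0.
  move=> i; rewrite mxE !big_ord_recl big_ord0 !mxE /= mulr1 mulr0 !addr0.
  by congr fun_of_matrix; exact: val_inj.
split=> [H H' [g Gg Hg] [g' Gg' Hg'] cHH'|a ea /eqP a0].
  exists (g 0 0 * g' 1 0 - g' 0 0 * g 1 0); split.
    by rewrite -!e1E; exact: lambda_length_of_spinors.
  have [_ eg] := figure_eight_eisenstein Gg;
    have [_ eg'] := figure_eight_eisenstein Gg'.
  by apply: eisensteinD; [|apply: eisensteinN]; apply: eisensteinM.
have [u [Uu [g Gg [g0 g1]]]] := orbit_second_coordinate ea.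
have u0 := eisenstein_unit_neq0 Uu.
exists u; split=> //.
pose k := 1 *m (\col_(i < 2) [:: 1; 0]`_i) : 'cV[R[i]]_2.
pose k' := g *m (\col_(i < 2) [:: 1; 0]`_i) : 'cV[R[i]]_2.
have k00 : k 0 0 = 1 by rewrite e1E mxE.
have k10 : k 1 0 = 0 by rewrite e1E mxE.
have k00' : k' 0 0 = u by rewrite e1E g0.
have k10' : k' 1 0 = u * a by rewrite e1E g1.
have kn : k != 0 by rewrite spinor_nz k00 xpair_eqE oner_eq0.
have kn' : k' != 0 by rewrite spinor_nz k00' xpair_eqE (negbTE u0).
exists (horosphere_of kn), (horosphere_of kn').
have cHH' : centre (horosphere_of kn) <> centre (horosphere_of kn').
  by rewrite /= /boundary_pt k10 k10' eqxx mulf_eq0 (negbTE u0) (negbTE a0).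
split=> //.
- by exists 1; [exact: figure_eight1|exact: horosphere_ofP].
- by exists g => //; exact: horosphere_ofP.
have := lambda_length_of_spinors (horosphere_ofP kn) (horosphere_ofP kn') cHH'.
by rewrite k00 k10 k10' mul1r mulr0 subr0.
Qed.
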